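(* If $(\Phi_n)$ is a family of acyclic conjunctive queries of size polynomially bounded in $n$ and of quantified star size bounded by a constant, then $(Q(\Phi_n))\in\mathbf{VP}$. Moreover, every family in $\mathbf{VP}$ is a p-projection of a family $(Q(\Phi_n))$ where the $\Phi_n$ are quantifier-free conjunctive queries of polynomial size whose hypergraph is a tree.
   Context: A conjunctive query $\Phi=(\mathcal{S},\phi)$: $\mathcal{S}$ finite relational structure with domain $D$, $\phi$ built from atoms with $\wedge,\exists$; $Q(\Phi)=\sum_{a\in\phi(\mathcal{S})}\prod_{x\in\mathrm{free}(\phi)}X_{a(x)}$, where $\phi(\mathcal{S})$ is the set of assignments $a$ of the free variables into $D$ satisfying $\phi$, in variables $X_d$ ($d\in D$). The hypergraph of $\phi$ has the variables as vertices and variable sets of atoms as hyperedges; acyclic means having a join tree (tree with nodes labeled by hyperedges, each used, such that for each vertex the nodes whose labels contain it are connected). For $\mathcal{H}=(V,E)$, $S\subseteq V$: $\mathcal{H}[S]=(S,\{e\cap S:e\cap S\ne\emptyset\})$, $\mathcal{H}[E']=(\bigcup E',E')$; a path from $A$ to $B$ is a sequence of hyperedges, consecutive intersecting, first meeting $A$, last meeting $B$; the $S$-component of $e\not\subseteq S$ is $\mathcal{H}[E']$ with $E'$ all $e'\not\subseteq S$ reachable by a path from $e\setminus S$ to $e'\setminus S$ in $\mathcal{H}[V\setminus S]$; an $S$-component $(V',E')$ is an $S$-$k$-star if some $y_1,\dots,y_k\in V'\cap S$ have no edge of $E$ containing two of them; the quantified star size is the maximal such $k$ with $S$ the free variables.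 $\mathbf{VP}$ is the class of polynomial families $(f_n)$ over a field of polynomially bounded degree computed by polynomial-size arithmetic circuits. $f$ is a projection of $g$ if $f=g(a_1,\dots,a_q)$ with each $a_i$ a field constant or a variable; $(f_n)$ is a p-projection of $(g_n)$ if there is a polynomial $r$ with $f_n$ a projection of $g_{r(n)}$ for all $n$. *)

(* Defs.v *)
From HB Require Import structures.
From mathcomp Require Import all_boot all_order all_algebra.
Set Implicit Arguments. Unset Strict Implicit. Unset Printing Implicit Defensive.
Import Order.TTheory GRing.Theory Num.Theory.
Local Open Scope ring_scope.

Fixpoint mpoly (R : comNzRingType) (k : nat) : comNzRingType :=
  match k with 0 => R | k'.+1 => {poly (mpoly R k')} end.

(* the variable X_i (for i >= k this is 0, never used meaningfully) *)
Fixpoint mvar (R : comNzRingType) (k : nat) (i : nat) : mpoly R k :=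
  match k return mpoly R k with
  | 0 => 0
  | k'.+1 => if i == k' then 'X else (mvar R k' i)%:P
  end.

Fixpoint mconst (R : comNzRingType) (k : nat) (c : R) : mpoly R k :=
  match k return mpoly R k with
  | 0 => c
  | k'.+1 => (mconst k' c)%:P
  end.

Fixpoint mdeg (R : comNzRingType) (k : nat) : mpoly R k -> nat :=
  match k return mpoly R k -> nat with
  | 0 => fun _ => 0%N
  | k'.+1 => fun p => (\max_(i < size p) (i + mdeg p`_i))%N
  end.

Fixpoint meval (R S : comNzRingType) (emb : R -> S) (sigma : nat -> S) (k : nat)
  : mpoly R k -> S :=
  match k return mpoly R k -> S with
  | 0 => fun c => emb c
  | k'.+1 => fun p => \sum_(i < size p) meval emb sigma p`_i * sigma k' ^+ i
  end.

Inductive gate (F : Type) :=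
| Gvar of nat
| Gconst of F
| Gadd of nat & nat
| Gmul of nat & nat.

Definition gate_val (F : fieldType) (k : nat) (g : gate F) (vals : seq (mpoly F k))
  : mpoly F k :=
  match g with
  | Gvar i => mvar F k i
  | Gconst c => mconst k c
  | Gadd i j => nth 0 vals i + nth 0 vals j
  | Gmul i j => nth 0 vals i * nth 0 vals j
  end.

Definition circuit_vals (F : fieldType) (k : nat) (C : seq (gate F)) : seq (mpoly F k) :=
  foldl (fun vals g => rcons vals (gate_val g vals)) [::] C.

Definition circuit_output (F : fieldType) (k : nat) (C : seq (gate F)) : mpoly F k :=
  last 0 (circuit_vals k C).

Definition poly_bounded (s : nat -> nat) : Prop :=
  exists c : nat, forall n : nat, (s n <= n ^ c + c)%N.

Definition inVP (F : fieldType) (k : nat -> nat) (f : forall n, mpoly F (k n)) : Prop :=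
  poly_bounded (fun n => mdeg (f n)) /\
  exists s : nat -> nat, poly_bounded s /\
    forall n, exists C : seq (gate F),
      (size C <= s n)%N /\ circuit_output (k n) C = f n.

Definition projection_of (F : fieldType) (kf kg : nat) (f : mpoly F kf) (g : mpoly F kg)
  : Prop :=
  exists a : nat -> F + nat,
    f = meval (mconst kf)
              (fun i => match a i with inl c => mconst kf c | inr j => mvar F kf j end) g.

Definition p_projection (F : fieldType) (kf : nat -> nat) (f : forall n, mpoly F (kf n))
  (kg : nat -> nat) (g : forall n, mpoly F (kg n)) : Prop :=
  exists r : {poly int}, (forall n : nat, 0 <= r.[n%:Z]) /\
    forall n : nat, projection_of (f n) (g `|r.[n%:Z]|%N).

(* Conjunctive queries (prenex form): a structure with domain 'I_dom,  *)
(* relations given by (arity, list of tuples), variables 'I_nv, a set  *)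
(* of free variables (the others are existentially quantified), and a  *)
(* list of atoms (relation index, argument variables).                 *)
Record CQ := mkCQ {
  cq_dom : nat;
  cq_nv : nat;
  cq_free : {set 'I_cq_nv};
  cq_rels : seq (nat * seq (seq 'I_cq_dom));
  cq_atoms : seq (nat * seq 'I_cq_nv) }.

Definition cq_wf (P : CQ) : bool :=
  all (fun r : nat * seq (seq 'I_(cq_dom P)) => all (fun t => size t == r.1) r.2) (cq_rels P) &&
  all (fun a : nat * seq 'I_(cq_nv P) =>
         (a.1 < size (cq_rels P))%N && (size a.2 == (nth (0%N, [::]) (cq_rels P) a.1).1))
      (cq_atoms P).

Definition cq_size (P : CQ) : nat :=
  (cq_dom P + cq_nv P
   + sumn [seq (size a.2).+1 | a <- cq_atoms P]
   + sumn [seq (r.1 + sumn (map size r.2)).+1 | r <- cq_rels P])%N.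

Definition cq_sat (P : CQ) (b : {ffun 'I_(cq_nv P) -> 'I_(cq_dom P)}) : bool :=
  all (fun a : nat * seq 'I_(cq_nv P) =>
         map b a.2 \in (nth (0%N, [::]) (cq_rels P) a.1).2) (cq_atoms P).

Definition fvar (P : CQ) := {x : 'I_(cq_nv P) | x \in cq_free P}.

Definition cq_answer (P : CQ) (a : {ffun fvar P -> 'I_(cq_dom P)}) : bool :=
  [exists b : {ffun 'I_(cq_nv P) -> 'I_(cq_dom P)},
     cq_sat b && [forall x : fvar P, b (val x) == a x]].

Definition cqQ (F : fieldType) (P : CQ) : mpoly F (cq_dom P) :=
  \sum_(a : {ffun fvar P -> 'I_(cq_dom P)} | cq_answer a)
     \prod_(x : fvar P) mvar F (cq_dom P) (a x).

Definition quantifier_free (P : CQ) : Prop := cq_free P = setT.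

Definition cq_edges (P : CQ) : {set {set 'I_(cq_nv P)}} :=
  [set:: [seq [set x in a.2] | a <- cq_atoms P]].

(* join tree: nodes 'I_k; the tree is given by a parent function
   (node i > 0 has parent par i < i, node 0 is the root) *)
Definition tree_adj (k : nat) (par : 'I_k -> 'I_k) : rel 'I_k :=
  fun i j => ((0 < i)%N && (par i == j)) || ((0 < j)%N && (par j == i)).

Definition join_tree (V : finType) (E : {set {set V}}) (k : nat)
  (par : 'I_k -> 'I_k) (lab : 'I_k -> {set V}) : Prop :=
  [/\ forall i : 'I_k, (0 < i)%N -> (par i < i)%N,
      forall i : 'I_k, lab i \in E,
      forall e, e \in E -> exists i : 'I_k, lab i = e &
      forall (v : V) (i j : 'I_k), v \in lab i -> v \in lab j ->
        connect (fun x y => [&& tree_adj par x y, v \in lab x & v \in lab y]) i j].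

Definition hyp_acyclic (V : finType) (E : {set {set V}}) : Prop :=
  exists k (par : 'I_k -> 'I_k) (lab : 'I_k -> {set V}), @join_tree V E k par lab.

Definition graph_adj (V : finType) (E : {set {set V}}) : rel V :=
  fun x y => [exists e in E, [&& x \in e, y \in e & x != y]].

Definition hyp_is_tree (V : finType) (E : {set {set V}}) : Prop :=
  [/\ forall e, e \in E -> #|e| = 2%N,
      (0 < #|V|)%N,
      forall x y : V, connect (graph_adj E) x y &
      forall s : seq V, uniq s -> (2 < size s)%N -> ~~ cycle (graph_adj E) s].

Section StarSize.
Variables (V : finType) (E : {set {set V}}) (S : {set V}).

Definition ES : {set {set V}} := [set e :\: S | e in E & ~~ (e \subset S)].

Definition hpath (A B : {set V}) : bool :=
  [exists f in ES, exists g in ES,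
     [&& f :&: A != set0, g :&: B != set0 &
         connect (fun f1 f2 => [&& f1 \in ES, f2 \in ES & f1 :&: f2 != set0]) f g]].

Definition comp_edges (e : {set V}) : {set {set V}} :=
  [set e' in E | ~~ (e' \subset S) && hpath (e :\: S) (e' :\: S)].

Definition comp_verts (e : {set V}) : {set V} := \bigcup_(e' in comp_edges e) e'.

Definition star_witness (e : {set V}) (Y : {set V}) : bool :=
  (Y \subset comp_verts e :&: S) && [forall f in E, #|f :&: Y| <= 1]%N.

Definition qstar_size : nat :=
  (\max_(e in E | ~~ (e \subset S)) \max_(Y : {set V} | star_witness e Y) #|Y|)%N.
End StarSize.

Definition cq_qss (P : CQ) : nat := qstar_size (cq_edges P) (cq_free P).

(* Main.v *)
Require Import Defs.
From HB Require Import structures.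
From Stdlib Require Import ClassicalEpsilon.
From mathcomp Require Import all_boot all_order all_algebra.
From mathcomp Require Import zify ring.

(** Upper bound. In a join tree replace the label [e] by the bag [(e ∪ V(C)) ∩ S], where [S] is the
    set of free variables and [C] the [S]-component of [e]. Bags containing a given variable still
    form a connected subtree, and an assignment of [S] is an answer iff each of its restrictions to
    a bag is the restriction of a satisfying assignment of the whole query. In an acyclic hypergraph
    a set of vertices is covered by as many edges as it has pairwise non-adjacent vertices, so a bag
    is covered by (quantified star size)-many edges and carries polynomially many such restrictions.
    Eliminating the bags leaf by leaf is then a polynomial-size circuit.

    Universality. The homogeneous components of the gates of a circuit, after solving for the
    additions and for the multiplications by constants, form a weighted grammar in Chomsky normal
    form. Cutting its derivation trees at the last node of size [> h] on a spine, as in the depth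
    reduction of Valiant, Skyum, Berkowitz and Rackoff, yields logarithmically many levels, each a
    short sum of products of three polynomials of the previous level. Unfolding the levels along the
    complete ternary tree turns the polynomial into a weighted sum of homomorphisms from a tree of
    polynomial size, i.e. a projection of the polynomial of a tree query. *)

Set Implicit Arguments. Unset Strict Implicit. Unset Printing Implicit Defensive.

(** * Acyclic hypergraphs and components *)

Lemma connect_crossing (T : finType) (e : rel T) (A : {pred T}) x y :
  connect e x y -> x \in A -> y \notin A ->
  exists a b, [/\ a \in A, b \notin A & e a b].
Proof.
case/connectP => p + ->; elim: p x => [|z p IHp] x /=; first by move=> _ ->.
case/andP => exz pz xA lA; case: (boolP (z \in A)) => zA; first exact: IHp pz zA lA.
by exists x, z.
Qed.

Lemma bag_adj_sym k (par : 'I_k -> 'I_k) (b : pred 'I_k) :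
  connect_sym (fun x y => [&& tree_adj par x y, b x & b y]).
Proof.
by apply: sym_connect_sym => x y; rewrite /tree_adj orbC [b x && _]andbC.
Qed.

Section RunningIntersection.
Variable V : finType.
Implicit Types (L : seq {set V}) (U Y : {set V}).

Definition vcover L : {set V} := \bigcup_(B <- L) B.

Lemma vcover_cons B L : vcover (B :: L) = B :|: vcover L.
Proof. by rewrite /vcover big_cons. Qed.

Lemma vcoverP L v : reflect (exists2 B, B \in L & v \in B) (v \in vcover L).
Proof.
elim: L => [|B L IHL]; first by rewrite /vcover big_nil inE; right=> -[].
rewrite vcover_cons inE; apply: (iffP orP) => [[vB|/IHL[C CL vC]]|[C]].
- by exists B; rewrite ?mem_head.
- by exists C; rewrite // inE CL orbT.
by rewrite inE => /predU1P[->|CL vC]; [left | right; apply/IHL; exists C].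
Qed.

(* The head of the list is the last bag in the elimination order. *)
Fixpoint running L : bool :=
  if L is x :: L' then
    running L' && ((L' == [::]) || has (fun y : {set V} => x :&: vcover L' \subset y) L')
  else true.

Lemma eq_vcover L L' : L =i L' -> vcover L = vcover L'.
Proof.
move=> eqL; apply/setP => v.
by apply/vcoverP/vcoverP => -[B BL vB]; exists B; rewrite ?eqL // -eqL.
Qed.

Lemma running_undup L : running L -> running (undup L).
Proof.
elim: L => //= x L IHL /andP[/IHL rL hL]; case: ifP => // _; rewrite /= rL /=.
rewrite (eq_vcover (mem_undup L)); case/orP: hL => [/eqP-> //|/hasP[y yL sy]].
by apply/orP; right; apply/hasP; exists y; rewrite ?mem_undup.
Qed.

(** Covering and packing are balanced greedily at the leaf [x]. A point of [U] lying in [x] but in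
    no other bag puts [x] into the cover and itself into [Y]. Without such a point [x] stays out of
    the cover, and it meets [Y] inside the bag on which it hangs. *)
Lemma running_duality L U : running L -> U \subset vcover L ->
  exists Y, exists2 C, [/\ Y \subset U, {subset C <= L} & U \subset vcover C] &
    size C <= #|Y| /\ {in L, forall f, #|f :&: Y| <= 1}.
Proof.
elim: L U => [|x L IHL] U /=.
  move=> _; rewrite /vcover big_nil subset0 => /eqP->.
  by exists set0, [::]; rewrite ?sub0set ?cards0.
case/andP => rL hL UxL; have [UL|/subsetPn[y yU yL]] := boolP (U \subset vcover L).
  have [Y [C [YU CL UC] [sz Y1]]] := IHL U rL UL.
  exists Y, C; split=> //; first by move=> f fC; rewrite inE CL ?orbT.
  move=> f; rewrite inE => /orP[/eqP->|]; last exact: Y1.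
  have YL := subset_trans YU UL.
  case/orP: hL => [/eqP L0|/hasP[z zL xz]].
    by move: YL; rewrite L0 /vcover big_nil subset0 => /eqP->; rewrite setI0 cards0.
  apply: leq_trans (subset_leq_card _) (Y1 z zL); rewrite subsetI subsetIr andbT.
  by apply: subset_trans xz; rewrite setIS.
(* Recursing on [U :\: x] keeps the other points of [Y] out of [x], so [y] is the only point of the
   packing in [x]. *)
have UxL' : U :\: x \subset vcover L by rewrite subDset -vcover_cons.
have yx : y \in x by move/subsetP/(_ y yU): UxL; rewrite vcover_cons inE (negPf yL) orbF.
have [Y [C [YU CL UC] [sz Y1]]] := IHL _ rL UxL'.
have yY : y \notin Y by apply/negP => /(subsetP YU); rewrite inE yx.
exists (y |: Y), (x :: C); split.
- by rewrite subUset sub1set yU (subset_trans YU) // subsetDl.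
- by move=> f; rewrite !inE => /orP[->|/CL->]; rewrite ?orbT.
- by rewrite vcover_cons -subDset.
- by rewrite cardsU1 yY.
move=> f; rewrite inE => /orP[/eqP->|fL].
  apply: leq_trans (subset_leq_card _) (eq_leq (cards1 y)).
  apply/subsetP => z; rewrite !inE => /andP[zx /orP[//|/(subsetP YU)]].
  by rewrite inE zx.
rewrite (_ : f :&: (y |: Y) = f :&: Y); first exact: Y1.
apply/setP => z; rewrite !inE; case: eqP => //= ->; rewrite (negPf yY) andbF andbT.
by apply: contraNF yL => yf; apply/vcoverP; exists f.
Qed.

Section TreeToList.
Variables (k : nat) (par : 'I_k -> 'I_k) (bag : 'I_k -> {set V}).
Hypothesis par_lt : forall i : 'I_k, 0 < i -> par i < i.
Hypothesis bag_connected : forall v i j, v \in bag i -> v \in bag j ->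
  connect (fun x y => [&& tree_adj par x y, v \in bag x & v \in bag y]) i j.

(** A walk from [i] to [l] through bags containing [v] must leave the subtree below [i], whose
    indices are all at least [i]; the only edge leaving that subtree joins [i] to [par i]. *)
Lemma bag_parent v (i l : 'I_k) : l < i -> v \in bag i -> v \in bag l -> v \in bag (par i).
Proof.
move=> li vi vl; pose up := fun a b : 'I_k => (0 < a) && (par a == b).
(* [A] is the set of descendants of [i], with [i] included. *)
pose A := [pred x | connect up x i].
have upA x : x \in A -> i <= x.
  rewrite inE => /connectP[p]; elim: p x => [|y p IHp] x /= => [_ ->//|].
  by case/andP=> /andP[x0 /eqP xy] py lE; apply: leq_trans (IHp y py lE) _; rewrite -xy ltnW ?par_lt.
have lA : l \notin A by apply/negP => /upA; rewrite leqNgt li.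
have iA : i \in A by rewrite inE connect0.
have [a [b [aA bA /and3P[adj va vb]]]] := connect_crossing (bag_connected vi vl) iA lA.
case/orP: adj => /andP[h0 /eqP hE]; last first.
  case/negP: bA; rewrite inE; apply: connect_trans (connect1 _) (aA : connect up a i).
  by rewrite /up h0 hE eqxx.
rewrite inE in aA; case/connectP: aA => -[|c p] /=; first by move=> _ ->; rewrite hE.
case/andP => /andP[_ /eqP ac] pc lE; case/negP: bA.
by rewrite inE; apply/connectP; exists p; rewrite -hE ac.
Qed.

Definition bag_list := [seq bag i | i <- rev (enum 'I_k)].

Lemma running_bag_list : running bag_list.
Proof.
(* Padding with [set0] lets the induction run over initial segments of the nodes; each new node
   hangs on its parent. *)
pose nb n := if insub n is Some i then bag i else set0.
have nbE (i : 'I_k) : nb i = bag i by rewrite /nb valK.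
suff H n : n <= k -> running [seq nb i | i <- rev (iota 0 n)].
  rewrite /bag_list; have := H k (leqnn k); rewrite -val_enum_ord -map_rev -map_comp.
  by rewrite (eq_map nbE).
elim: n => // n IHn nk; rewrite -{1}addn1 iotaD rev_cat /= IHn ?(ltnW nk) //=.
case: (posnP n) => [-> //|n0]; apply/orP; right; pose i := Ordinal nk.
apply/hasP; exists (nb (par i)).
  by rewrite map_f // mem_rev mem_iota /= par_lt.
apply/subsetP => v; rewrite inE (nbE i) nbE => /andP[vi /vcoverP[B /mapP[l]]].
rewrite mem_rev mem_iota /= => ln -> vl; have lk := ltn_trans ln nk.
by apply: (@bag_parent v i (Ordinal lk)) => //; rewrite -nbE.
Qed.

End TreeToList.
End RunningIntersection.

(** * Components relative to the free variables, and their bags *)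

Section Components.
Variables (V : finType) (E : {set {set V}}) (S : {set V}).

Definition comp_rel : rel {set V} :=
  fun f1 f2 => [&& f1 \in ES E S, f2 \in ES E S & f1 :&: f2 != set0].

Lemma comp_rel_sym : symmetric comp_rel.
Proof. by move=> f g; rewrite /comp_rel setIC andbCA. Qed.

Lemma mem_ES e : e \in E -> ~~ (e \subset S) -> e :\: S \in ES E S.
Proof. by move=> eE eS; apply/imsetP; exists e; rewrite ?inE ?eE. Qed.

Lemma comp_rel_share e e' u : e \in E -> e' \in E -> u \in e -> u \in e' -> u \notin S ->
  comp_rel (e :\: S) (e' :\: S).
Proof.
move=> eE e'E ue ue' uS; have nS (f : {set V}) : u \in f -> ~~ (f \subset S).
  by move=> uf; apply/subsetPn; exists u.
rewrite /comp_rel !mem_ES ?nS //=; apply/set0Pn; exists u.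
by rewrite !inE uS ue ue'.
Qed.

Lemma hpathE e e' : e \in E -> ~~ (e \subset S) -> e' \in E -> ~~ (e' \subset S) ->
  hpath E S (e :\: S) (e' :\: S) = connect comp_rel (e :\: S) (e' :\: S).
Proof.
move=> eE eS e'E e'S; have nz (f : {set V}) : ~~ (f \subset S) -> (f :\: S) :&: (f :\: S) != set0.
  by rewrite setIid setD_eq0.
apply/existsP/idP => [[f /andP[fE /existsP[g /and4P[gE fe ge fg]]]]|c].
  apply: (connect_trans (connect1 _) (connect_trans fg (connect1 _))).
    by rewrite /comp_rel mem_ES // fE setIC.
  by rewrite /comp_rel mem_ES // gE.
exists (e :\: S); rewrite mem_ES //; apply/existsP; exists (e' :\: S).
by rewrite mem_ES //= !nz.
Qed.

Lemma comp_edges_share e e' u : e \in E -> e' \in E -> u \in e -> u \in e' -> u \notin S ->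
  comp_edges E S e = comp_edges E S e'.
Proof.
move=> eE e'E ue ue' uS; have nS (f : {set V}) : u \in f -> ~~ (f \subset S).
  by move=> uf; apply/subsetPn; exists u.
apply/setP => f; rewrite !inE; case: (boolP (f \in E)) => //= fE.
case: (boolP (f \subset S)) => //= fS; rewrite !hpathE ?(nS e ue) ?(nS e' ue') //.
have sy := sym_connect_sym comp_rel_sym.
exact: same_connect (sy) _ _ (connect1 (comp_rel_share eE e'E ue ue' uS)) _.
Qed.

Lemma comp_edges_sub (e : {set V}) : e \subset S -> comp_edges E S e = set0.
Proof.
rewrite -setD_eq0 => /eqP eS; apply/setP => f; rewrite !inE eS.
suff -> : hpath E S set0 (f :\: S) = false by rewrite !andbF.
by apply/existsP => -[g /andP[_ /existsP[h /and4P[_]]]]; rewrite setI0 eqxx.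
Qed.

Lemma comp_edges_refl e : e \in E -> ~~ (e \subset S) -> e \in comp_edges E S e.
Proof. by move=> eE eS; rewrite inE eE eS hpathE ?connect0. Qed.

(** For [e] inside [S] the component is empty and the bag is [e]; otherwise [e] belongs to its own
    component and the union adds nothing. *)
Definition comp_bag (e : {set V}) : {set V} := (e :|: comp_verts E S e) :&: S.

Lemma comp_bagE e : e \in E -> ~~ (e \subset S) -> comp_bag e = comp_verts E S e :&: S.
Proof.
move=> eE eS; rewrite /comp_bag (setUidPr _) //.
by apply: bigcup_sup; exact: comp_edges_refl.
Qed.

Lemma comp_bag_share e e' u : e \in E -> e' \in E -> u \in e -> u \in e' -> u \notin S ->
  comp_bag e = comp_bag e'.
Proof.
move=> eE e'E ue ue' uS; rewrite !comp_bagE //; try by apply/subsetPn; exists u.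
by rewrite /comp_verts (comp_edges_share eE e'E ue ue' uS).
Qed.

Variables (k : nat) (par : 'I_k -> 'I_k) (lab : 'I_k -> {set V}).
Hypothesis JT : join_tree E par lab.

(** A node whose bag contains [v] is linked, along a hyperedge path of its component, to a node
    whose label contains [v]; nodes of the latter kind are connected by the join tree property. *)
Lemma comp_bag_connected v i j : v \in comp_bag (lab i) -> v \in comp_bag (lab j) ->
  connect (fun x y => [&& tree_adj par x y, v \in comp_bag (lab x) & v \in comp_bag (lab y)]) i j.
Proof.
have [_ labE labS labC] := JT; set T := (fun x y => _).
have Tsym : connect_sym T := bag_adj_sym par (fun x => v \in comp_bag (lab x)).
move=> vi vj; have vS : v \in S by move: vi; rewrite inE => /andP[].
(* The join tree links [a] and [b] through labels containing [u]. As [u] is quantified, all these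
   labels have the same component, so all their bags contain [v]. *)
have step a b u : u \in lab a -> u \in lab b -> u \notin S -> v \in comp_verts E S (lab a) ->
    connect T a b.
  move=> ua ub uS va; apply: connect_sub (labC u a b ua ub) => x y /and3P[xy ux uy].
  have vu z : u \in lab z -> v \in comp_bag (lab z).
    move=> uz; rewrite !inE vS andbT; apply/orP; right; move: va; rewrite /comp_verts.
    by rewrite (comp_edges_share (labE a) (labE z) ua uz).
  apply: connect1; apply/and3P; split; [exact: xy | exact: vu | exact: vu].
(* Consecutive hyperedges of the path share a quantified vertex, so [step] applies to each pair. *)
have walk p a b : path comp_rel (lab a :\: S) p -> v \in comp_verts E S (lab a) ->
    lab b :\: S = last (lab a :\: S) p -> connect T a b.
  elim: p a => [|f p IHp] a /=.
    move=> _ va lE; have [aS|/subsetPn[u ua uS]] := boolP (lab a \subset S).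
      by move: va; rewrite /comp_verts comp_edges_sub // big_set0 inE.
    have : u \in lab b :\: S by rewrite lE inE uS.
    by rewrite inE => /andP[_ ub]; exact: step ua ub uS va.
  case/andP => /and3P[_ /imsetP[e]]; rewrite inE => /andP[eE _] -> /set0Pn[u].
  rewrite !inE => /andP[/andP[uS ua] /andP[_ ue]] pe va.
  have [c ce] := labS e eE; rewrite -ce in pe ue *; move=> lE.
  apply: (connect_trans (step a c u ua ue uS va)); apply: IHp pe _ lE.
  by rewrite /comp_verts -(comp_edges_share (labE a) (labE c) ua ue).
have toLab a : v \in comp_bag (lab a) -> exists2 b, v \in lab b & connect T a b.
  rewrite !inE => /andP[/orP[va|va] _]; first by exists a.
  have /bigcupP[e] := va; rewrite inE => /and3P[eE eS ha] ve.
  have [b be] := labS e eE; exists b; first by rewrite be.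
  have aS : ~~ (lab a \subset S).
    apply/negP => aS; move: va; rewrite /comp_verts comp_edges_sub // big_set0 inE //.
  move: ha; rewrite hpathE // => /connectP[p pp lE]; apply: walk pp va _.
  by rewrite be.
have [a va ia] := toLab i vi; have [b vb jb] := toLab j vj.
apply: (connect_trans ia); rewrite Tsym in jb; apply: connect_trans jb.
apply: connect_sub (labC v a b va vb) => x y /and3P[xy vx vy].
have vb' z : v \in lab z -> v \in comp_bag (lab z) by move=> vz; rewrite !inE vz vS.
apply: connect1; apply/and3P; split; [exact: xy | exact: vb' | exact: vb'].
Qed.

Definition comp_bags := undup [seq comp_bag (lab i) | i <- rev (enum 'I_k)].

Lemma running_comp_bags : running comp_bags.
Proof.
apply: running_undup; apply: (@running_bag_list _ _ par (fun i => comp_bag (lab i))).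
  by case: JT.
exact: comp_bag_connected.
Qed.

Lemma mem_comp_bags B : (B \in comp_bags) = (B \in [seq comp_bag e | e <- enum E]).
Proof.
have [_ labE labS _] := JT; rewrite mem_undup; apply/mapP/mapP => [[i _ ->]|[e]].
  by exists (lab i); rewrite ?mem_enum.
by rewrite mem_enum => /labS[i <-] ->; exists i; rewrite ?mem_rev ?mem_enum.
Qed.

Lemma running_labels : running [seq lab i | i <- rev (enum 'I_k)].
Proof. by case: JT => H1 _ _ H2; apply: running_bag_list H2. Qed.

(** Duality is applied to the bag and the list of all labels: the packing [Y] it returns is a star
    witness for [e], so its size is at most the star size. *)
Lemma comp_cover e : e \in E -> ~~ (e \subset S) -> exists2 C : seq {set V},
  (size C <= qstar_size E S)%N & {subset C <= E} /\ comp_bag e \subset vcover C.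
Proof.
have [_ labE labS _] := JT; move=> eE eS.
have memL f : (f \in [seq lab i | i <- rev (enum 'I_k)]) = (f \in E).
  apply/mapP/idP => [[i _ ->] //|/labS[i <-]].
  by exists i; rewrite ?mem_rev ?mem_enum.
have bE := comp_bagE eE eS.
have [|Y [C [YU CL UC] [sz Y1]]] := running_duality running_labels (_ : comp_bag e \subset _).
  rewrite bE; apply/subsetP => v; rewrite inE => /andP[/bigcupP[f]].
  by rewrite inE => /andP[fE _] vf _; apply/vcoverP; exists f; rewrite ?memL.
exists C; last by split=> // f /CL; rewrite memL.
apply: (leq_trans sz); rewrite /qstar_size.
apply: (leq_trans _ (@leq_bigmax_cond _ _ (fun e => \max_(Y0 | star_witness E S e Y0) #|Y0|) e _)).
  apply: (@leq_bigmax_cond _ _ (fun Y0 : {set V} => #|Y0|) Y).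
  rewrite /star_witness -bE YU; apply/forallP => f; apply/implyP => fE.
  by apply: Y1; rewrite memL.
by rewrite eE.
Qed.
End Components.

Import Order.TTheory GRing.Theory Num.Theory.
Local Open Scope ring_scope.

(** * Iterated polynomials *)

Fact mconst_is_zmod_morphism (R : comNzRingType) k : zmod_morphism (@mconst R k).
Proof. by elim: k => [|k IHk] //= x y; rewrite IHk polyCB. Qed.

Fact mconst_is_monoid_morphism (R : comNzRingType) k : monoid_morphism (@mconst R k).
Proof.
elim: k => [|k [IH1 IHM]] //=; split=> [|x y]; first by rewrite IH1.
by rewrite IHM polyCM.
Qed.

HB.instance Definition _ (R : comNzRingType) k :=
  GRing.isZmodMorphism.Build R (mpoly R k) (@mconst R k) (@mconst_is_zmod_morphism R k).
HB.instance Definition _ (R : comNzRingType) k :=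
  GRing.isMonoidMorphism.Build R (mpoly R k) (@mconst R k) (@mconst_is_monoid_morphism R k).

Section Eval.
Variables (R S : comNzRingType) (emb : {rmorphism R -> S}) (sigma : nat -> S).

Fact meval_morphism k :
  zmod_morphism (@meval R S emb sigma k) /\ monoid_morphism (@meval R S emb sigma k).
Proof.
elim: k => [|k [IHB [IH1 IHM]]].
  by split; [exact: rmorphB | split; [exact: rmorph1 | exact: rmorphM]].
(* The induction hypothesis is packed as a morphism, so that evaluation in one more variable is a
   coefficientwise morphism followed by Horner evaluation. *)
pose h1 := GRing.isZmodMorphism.Build _ _ _ IHB.
pose h2 := GRing.isMonoidMorphism.Build _ _ (@meval R S emb sigma k) (conj IH1 IHM).
pose f : {rmorphism _ -> _} := HB.pack (@meval R S emb sigma k) h1 h2.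
have E (p : mpoly R k.+1) : meval emb sigma p = (map_poly f p).[sigma k].
  by rewrite /= horner_poly.
split=> [p q|]; first by rewrite !E rmorphB hornerD hornerN.
by split=> [|p q]; rewrite !E ?rmorph1 ?hornerE // rmorphM hornerM.
Qed.

HB.instance Definition _ k := GRing.isZmodMorphism.Build (mpoly R k) S
  (@meval R S emb sigma k) (meval_morphism k).1.
HB.instance Definition _ k := GRing.isMonoidMorphism.Build (mpoly R k) S
  (@meval R S emb sigma k) (meval_morphism k).2.

Lemma meval_mconst k c : meval emb sigma (mconst k c) = emb c.
Proof.
elim: k => [|k IHk] //=; rewrite size_polyC.
have [c0|] := eqVneq (mconst k c) 0; last by rewrite big_ord1 coefC mulr1.
by rewrite big_ord0 -IHk c0 rmorph0.
Qed.

Lemma meval_polyC k (p : mpoly R k) :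
  @meval R S emb sigma k.+1 p%:P = meval emb sigma p.
Proof.
rewrite /= size_polyC; have [->|] := eqVneq p 0; first by rewrite big_ord0 rmorph0.
by rewrite big_ord1 coefC mulr1.
Qed.

Lemma meval_mvar k i : (i < k)%N -> meval emb sigma (mvar R k i) = sigma i.
Proof.
elim: k => [|k IHk] // lt_ik; rewrite [mvar _ _ _]/=.
have [->|ne_ik] := eqVneq i k; last by rewrite meval_polyC IHk // ltn_neqAle ne_ik.
by rewrite /= size_polyX !big_ord_recl big_ord0 !coefX /= rmorph0 rmorph1 mul0r add0r mul1r addr0.
Qed.

End Eval.

Lemma mvar_out (R : comNzRingType) k i : (k <= i)%N -> mvar R k i = 0.
Proof.
elim: k => [|k IHk] //= lt_ki; rewrite gtn_eqF // IHk //; exact: ltnW.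
Qed.

Lemma eq_meval (R S : comNzRingType) (e1 e2 : R -> S) (s1 s2 : nat -> S) k :
  e1 =1 e2 -> (forall i, (i < k)%N -> s1 i = s2 i) ->
  meval e1 s1 (k := k) =1 meval e2 s2 (k := k).
Proof.
move=> Ee; elim: k => [|k IHk] //= Es p.
by apply: eq_bigr => i _; rewrite Es // IHk // => j lt_jk; rewrite Es // ltnW.
Qed.

Lemma rmorph_meval (R S T : comNzRingType) (f : {rmorphism S -> T}) (e : R -> S) s k
    (p : mpoly R k) :
  f (meval e s p) = meval (f \o e) (f \o s) p.
Proof.
elim: k p => [|k IHk] p //=; rewrite rmorph_sum; apply: eq_bigr => i _.
by rewrite rmorphM rmorphXn /= IHk.
Qed.

Lemma meval_id (R : comNzRingType) k (p : mpoly R k) : meval (mconst k) (mvar R k) p = p.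
Proof.
elim: k p => [|k IHk] p //=; rewrite -[RHS]coefK poly_def; apply: eq_bigr => i _.
rewrite eqxx -mul_polyC; congr (_ * _); rewrite -[in RHS](IHk p`_i).
rewrite -[RHS]/(polyC _) rmorph_meval; apply: eq_meval => // j ltjk /=.
by rewrite ltn_eqF.
Qed.

Section Degree.
Variable R : comNzRingType.

Lemma mdeg0 k : mdeg (0 : mpoly R k) = 0%N.
Proof. by case: k => [|k] //=; rewrite size_poly0 big_ord0. Qed.

Lemma mdeg_coef k (p : mpoly R k.+1) i : (i < size p)%N -> (i + mdeg p`_i <= mdeg p)%N.
Proof. by move=> lt_ip; rewrite /= (leq_bigmax (Ordinal lt_ip)). Qed.

Lemma mdeg_leq k (p : mpoly R k.+1) n :
  (forall i, (i < size p)%N -> (i + mdeg p`_i <= n)%N) -> (mdeg p <= n)%N.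
Proof. by move=> H; apply/bigmax_leqP => i _; exact: H. Qed.

Lemma mdegD k (p q : mpoly R k) : (mdeg (p + q)%R <= maxn (mdeg p) (mdeg q))%N.
Proof.
elim: k p q => [|k IHk] // p q; apply: mdeg_leq => i lt_i; rewrite coefD.
have [lt_ip|le_pi] := ltnP i (size p); last first.
  rewrite (nth_default _ le_pi) add0r leq_max mdeg_coef ?orbT //.
  rewrite ltnNge; apply/negP => le_qi; move: lt_i; rewrite ltnNge.
  by rewrite (leq_trans (size_polyD _ _)) // geq_max le_pi.
have [lt_iq|le_qi] := ltnP i (size q); last first.
  by rewrite (nth_default _ le_qi) addr0 leq_max mdeg_coef.
rewrite (leq_trans (leq_add (leqnn i) (IHk _ _))) // addn_maxr.
by rewrite geq_max !leq_max !mdeg_coef ?orbT.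
Qed.

Lemma mdeg_sum k I r (P : pred I) (F : I -> mpoly R k) n :
  (forall i, P i -> (mdeg (F i) <= n)%N) -> (mdeg (\sum_(i <- r | P i) F i)%R <= n)%N.
Proof.
move=> H; elim/big_rec: _ => [|i x Pi IH]; first by rewrite mdeg0.
by rewrite (leq_trans (mdegD _ _)) // geq_max H.
Qed.

Lemma mdegM k (p q : mpoly R k) : (mdeg (p * q)%R <= mdeg p + mdeg q)%N.
Proof.
elim: k p q => [|k IHk] // p q; apply: mdeg_leq => i lt_i.
have [p0|p0] := eqVneq p 0; first by rewrite p0 mul0r size_poly0 in lt_i.
have [q0|q0] := eqVneq q 0; first by rewrite q0 mulr0 size_poly0 in lt_i.
have sz (r : mpoly R k.+1) : r != 0 -> ((size r).-1 <= mdeg r)%N.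
  rewrite -size_poly_gt0 => r0; rewrite (leq_trans _ (@mdeg_coef k r (size r).-1 _)) ?leq_addr //.
  by rewrite prednK.
have lt_i2 : (i <= (size p).-1 + (size q).-1)%N.
  move: (leq_trans lt_i (size_polyMleq _ _)) p0 q0; rewrite -!size_poly_gt0; lia.
have le_i := leq_trans lt_i2 (leq_add (sz p p0) (sz q q0)).
rewrite coefM -leq_subRL //; apply: mdeg_sum => j _; rewrite leq_subRL //.
have [lt_jp|le_pj] := ltnP j (size p); last by rewrite (nth_default _ le_pj) mul0r mdeg0 addn0.
have [lt_jq|le_qj] := ltnP (i - j)%N (size q); last by rewrite (nth_default _ le_qj) mulr0 mdeg0 addn0.
have := IHk p`_j q`_(i - j); have := mdeg_coef lt_jp; have := mdeg_coef lt_jq.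
have := ltn_ord j; move: (mdeg (_ * _)) => a; lia.
Qed.

Lemma mdeg_mconst k (c : R) : mdeg (mconst k c) = 0%N.
Proof.
elim: k => [|k IHk] //=; apply/eqP; rewrite -leqn0; apply/bigmax_leqP => -[i /=].
by rewrite size_polyC coefC; case: eqP => //= _; case: i => //= _; rewrite IHk.
Qed.

Lemma mdeg_mvar k i : (mdeg (mvar R k i) <= 1)%N.
Proof.
elim: k => [|k IHk] //; apply: mdeg_leq => j; rewrite /=; case: eqP => _.
  rewrite size_polyX coefX; case: j => [|[|j]] //= _; first by rewrite mdeg0.
  by rewrite (_ : mdeg _ = 0%N) // -(rmorph1 (mconst k)) mdeg_mconst.
by rewrite size_polyC coefC; case: eqP => //= _; case: j.
Qed.

Lemma mdeg_prod k I r (P : pred I) (F : I -> mpoly R k) :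
  (mdeg (\prod_(i <- r | P i) F i)%R <= \sum_(i <- r | P i) mdeg (F i))%N.
Proof.
elim/big_rec2: _ => [|i x y Pi IH]; first by rewrite -(rmorph1 (mconst k)) mdeg_mconst.
by rewrite (leq_trans (mdegM _ _)) // leq_add2l.
Qed.

(** Applied to [hgrade], this makes the components beyond the total degree vanish. *)
Lemma size_meval_leq (S : comNzRingType) (e : R -> {poly S}) (s : nat -> {poly S}) k
    (p : mpoly R k) :
  (forall c, (size (e c) <= 1)%N) -> (forall i, (size (s i) <= 2)%N) ->
  (size (meval e s p) <= (mdeg p).+1)%N.
Proof.
move=> He Hs; elim: k p => [|k IHk] p //.
rewrite [meval _ _ _]/=; apply: (leq_trans (size_sum _ _ _)); apply/bigmax_leqP => i _.
have sX : (size (s k ^+ i) <= i.+1)%N.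
  apply: (leq_trans (size_poly_exp_leq _ _)); rewrite ltnS.
  by rewrite -[leqRHS]mul1n leq_mul //; case: (size _) (Hs k) => [|[|[]]].
apply: (leq_trans (size_polyMleq _ _)).
have := mdeg_coef (ltn_ord i); have := IHk p`_i; move: sX.
set q := meval e s _; set t := s k ^+ i; move: (size (t : {poly S})) (size (q : {poly S})) => a b; lia.
Qed.

End Degree.

(** * Homogeneous components *)

Section HomogeneousComponents.
Variables (R : comNzRingType) (k : nat).

(** Every variable is multiplied by a new indeterminate; the coefficient of its [a]-th power is then
    the homogeneous component of degree [a]. *)
Definition hgrade (p : mpoly R k) : {poly mpoly R k} :=
  meval (polyC \o mconst k) (fun i => mvar R k i *: 'X) p.

HB.instance Definition _ := GRing.RMorphism.copy hgrade
  (meval (polyC \o mconst k) (fun i => mvar R k i *: 'X) (k := k)).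

Definition hcomp a (p : mpoly R k) := (hgrade p)`_a.

Lemma hcompD a p q : hcomp a (p + q) = hcomp a p + hcomp a q.
Proof. by rewrite /hcomp rmorphD coefD. Qed.

Lemma hcomp0 a : hcomp a 0 = 0.
Proof. by rewrite /hcomp rmorph0 coef0. Qed.

Lemma hcompM a p q : hcomp a (p * q) = \sum_(b < a.+1) hcomp b p * hcomp (a - b) q.
Proof. by rewrite /hcomp rmorphM coefM. Qed.

Lemma hcomp_mconst a c : hcomp a (mconst k c) = if a == 0%N then mconst k c else 0.
Proof. by rewrite /hcomp /hgrade meval_mconst coefC. Qed.

Lemma hcomp_mvar a i : hcomp a (mvar R k i) = if a == 1%N then mvar R k i else 0.
Proof.
have [le_ki|lt_ik] := leqP k i; first by rewrite mvar_out // hcomp0 if_same.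
by rewrite /hcomp /hgrade meval_mvar // coefZ coefX; case: eqP; rewrite ?mulr1 ?mulr0.
Qed.

(** Setting the grading indeterminate to 0 evaluates [p] at the origin. *)
Lemma hcomp0_const p : exists c, hcomp 0 p = mconst k c.
Proof.
exists (meval idfun (fun=> 0) p); rewrite /hcomp -horner_coef0 -horner_evalE.
rewrite rmorph_meval rmorph_meval; apply: eq_meval => [c|i _] /=.
  by rewrite horner_evalE hornerC.
by rewrite horner_evalE !hornerE rmorph0.
Qed.

(** Setting the grading indeterminate to 1 gives [p] back. *)
Lemma hcomp_sum p d : (mdeg p <= d)%N -> p = \sum_(a < d.+1) hcomp a p.
Proof.
move=> le_pd; rewrite -[LHS]meval_id.
have -> : meval (mconst k) (mvar R k) p = (hgrade p).[1].
  rewrite -horner_evalE rmorph_meval; apply: eq_meval => [c|i _] /=.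
    by rewrite horner_evalE hornerC.
  by rewrite horner_evalE !hornerE.
rewrite (@horner_coef_wide _ d.+1); last first.
  apply: (leq_trans (size_meval_leq _ _ _)) => [c|i|] //=; first exact: size_polyC_leq1.
  by apply: (leq_trans (size_scale_leq _ _)); rewrite size_polyX.
by apply: eq_bigr => i _; rewrite expr1n mulr1.
Qed.

End HomogeneousComponents.

(** * Depth reduction for weighted grammars *)

(** In the use below [b] is the size of the child entered and [m] the size of the node ending the
    spine; the new index is [b - m], the size of the context between them. *)
Lemma exchange_triangle (V : nmodType) h n (T : nat -> nat -> V) :
  \sum_(b < n | (h < b)%N) \sum_(m < b.+1 | (h < m)%N) T b m =
  \sum_(m < n | (h < m)%N) \sum_(b < n - m) T (b + m)%N m.
Proof.
transitivity (\sum_(b < n | (h < b)%N) \sum_(m < n | (h < m)%N && (m <= b)%N) T b m).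
  apply: eq_bigr => b _.
  by rewrite (big_ord_widen_cond n (fun m => (h < m)%N) (T b)).
rewrite (exchange_big_dep (fun m : 'I_n => (h < m)%N)) /=; last by move=> b m _ /andP[].
apply: eq_bigr => m hm; rewrite -(big_mkord xpredT (fun b => T (b + m)%N m)).
rewrite -{1}(add0n m) -(big_addn 0 n m xpredT (fun b => T b m)) big_geq_mkord.
by apply: eq_bigl => b; rewrite /= hm; apply: andb_idl; exact: leq_trans.
Qed.

Section SumsOfTriples.
Variable R : comNzRingType.

Definition sum3 (A : R -> Prop) N (p : R) :=
  exists2 ts : seq (R * R * R), (size ts <= N)%N &
    (forall t, t \in ts -> [/\ A t.1.1, A t.1.2 & A t.2]) /\
    p = \sum_(t <- ts) t.1.1 * t.1.2 * t.2.

Variable A : R -> Prop.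

Lemma sum3_leq N N' p : (N <= N')%N -> sum3 A N p -> sum3 A N' p.
Proof. by move=> leN [ts /leq_trans/(_ leN) ? ?]; exists ts. Qed.

Lemma sum3_0 N : sum3 A N 0.
Proof. by exists [::] => //; rewrite big_nil. Qed.

Lemma sum3_mul x y z : A x -> A y -> A z -> sum3 A 1 (x * y * z).
Proof.
by move=> *; exists [:: (x, y, z)]; rewrite ?big_seq1; split=> // t; rewrite inE => /eqP->.
Qed.

Lemma sum3D N N' p q : sum3 A N p -> sum3 A N' q -> sum3 A (N + N') (p + q).
Proof.
move=> [ts sz [tsA ->]] [ts' sz' [tsA' ->]]; exists (ts ++ ts').
  by rewrite size_cat leq_add.
by split=> [t|]; rewrite ?big_cat // mem_cat => /orP[/tsA|/tsA'].
Qed.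

Lemma sum3_sum n (C : pred 'I_n) (F : 'I_n -> R) N :
  (forall i, C i -> sum3 A N (F i)) -> sum3 A (n * N) (\sum_(i < n | C i) F i).
Proof.
move=> H; suff {1}<- : size (index_enum 'I_n) = n.
  elim: (index_enum _) => [|i e IHe]; rewrite ?big_nil ?big_cons; first exact: sum3_0.
  case: ifP => [Ci|_]; first by rewrite mulSn; apply: sum3D; first exact: H.
  by apply: sum3_leq IHe; rewrite leq_mul2r leqnSn orbT.
by rewrite -[index_enum _](enumT 'I_n) -cardE card_ord.
Qed.

End SumsOfTriples.

Section Levels.
Variables (R : comNzRingType) (base : R -> Prop) (G : seq R) (N : nat).

(** Every polynomial that occurs must come from the finite stock [G]; this keeps the domain of the
    final query small. *)
Fixpoint lev q (p : R) : Prop :=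
  p \in G /\ if q is q'.+1 then sum3 (lev q') N p else base p.

Lemma lev_mem q p : lev q p -> p \in G. Proof. by case: q => [|q] []. Qed.

Hypotheses (N_gt0 : (0 < N)%N) (G1 : 1 \in G) (base1 : base 1).

Lemma lev1 q : lev q 1.
Proof.
elim: q => [|q IHq] //=; split=> //; apply: (sum3_leq N_gt0).
by rewrite -[1](mulr1 1) -{1}[1](mulr1 1); exact: sum3_mul.
Qed.
End Levels.

(** Writing [p] as [p * 1 * 1] makes the levels cumulative, so factors of different depth can be
    brought to a common one. *)
Lemma lev_succ (R : comNzRingType) base (G : seq R) N q p :
  (0 < N)%N -> 1 \in G -> base 1 -> lev base G N q p -> lev base G N q.+1 p.
Proof.
move=> N_gt0 G1 b1 H; split; first exact: lev_mem H.
apply: (sum3_leq N_gt0); rewrite -[p]mulr1 -[p * 1]mulr1.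
by apply: sum3_mul => //; exact: lev1.
Qed.

Section Grammar.
Variables (R : comNzRingType) (s : nat) (P L : nat -> nat -> R) (l r : nat -> nat).

(** Weight of the derivations from [u] with a hole in place of the production [w], where [c] is the
    size generated outside the hole. Each step passes to some [b < c], so fuel [c.+1] suffices. *)
Fixpoint ctx_fuel n c u w : R :=
  if n is n'.+1 then
    if c == 0%N then L u w else
    \sum_(v < s) L u v * \sum_(b < c)
      (ctx_fuel n' b (l v) w * P (c - b) (r v) + P (c - b) (l v) * ctx_fuel n' b (r v) w)
  else 0.

Definition ctx c := ctx_fuel c.+1 c.

Lemma ctx_fuelE n c u w : (c < n)%N -> ctx_fuel n c u w = ctx c u w.
Proof.
suff H m c' u' w' : (c' < n)%N -> (c' < m)%N -> ctx_fuel n c' u' w' = ctx_fuel m c' u' w'.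
  by move=> cn; exact: H.
elim: n m c' u' w' => [|n IHn] [|m] c' u' w' //= cn cm.
case: eqP => // _; apply: eq_bigr => v _; congr (_ * _).
by apply: eq_bigr => b _; have ltb := ltn_ord b; rewrite !(IHn m) //; lia.
Qed.

Lemma ctxE c u w : (0 < c)%N -> ctx c u w = \sum_(v < s) L u v * \sum_(b < c)
  (ctx b (l v) w * P (c - b) (r v) + P (c - b) (l v) * ctx b (r v) w).
Proof.
move=> c0; have cS n : ctx_fuel n.+1 c u w = if c == 0%N then L u w else
  \sum_(v < s) L u v * \sum_(b < c) (ctx_fuel n b (l v) w * P (c - b) (r v)
    + P (c - b) (l v) * ctx_fuel n b (r v) w) by [].
rewrite {1}/ctx cS gtn_eqF //; apply: eq_bigr => v _; congr (_ * _).
by apply: eq_bigr => b _; rewrite !ctx_fuelE.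
Qed.

Hypotheses (l_lt : forall v, (v < s)%N -> (l v < s)%N)
           (r_lt : forall v, (v < s)%N -> (r v < s)%N).

(* [X n u] is the weight of derivations from [u] of size [n]; following the unique child of size
   [> h] downwards ends at a node of size [m > h] whose own contribution is [Y m]. *)
Lemma spine_decomposition (X Y : nat -> nat -> R) h n0 :
  (forall n u, (h < n <= n0)%N -> (u < s)%N -> X n u = \sum_(v < s) L u v *
     (Y n v + \sum_(b < n | (h < b)%N)
        (X b (l v) * P (n - b) (r v) + P (n - b) (l v) * X b (r v)))) ->
  forall n u, (h < n <= n0)%N -> (u < s)%N ->
    X n u = \sum_(m < n.+1 | (h < m)%N) \sum_(v < s) ctx (n - m) u v * Y m v.
Proof.
move=> HX; elim/ltn_ind => n IHn u hn us; have /andP[lt_hn le_nn0] := hn.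
(* The summand [m = n] is the spine that stops at once: its context has size 0 and weight
   [L u v]. *)
rewrite [RHS]big_mkcond big_ord_recr -big_mkcond /= lt_hn subnn HX //.
under [LHS]eq_bigr do rewrite mulrDr.
rewrite big_split /= addrC; congr (_ + _).
transitivity (\sum_(m < n | (h < m)%N) \sum_(w < s) \sum_(v < s) L u v *
  (\sum_(b < n - m) (ctx b (l v) w * P (n - m - b) (r v)
     + P (n - m - b) (l v) * ctx b (r v) w) * Y m w)); last first.
  apply: eq_bigr => m hm; apply: eq_bigr => w _.
  rewrite ctxE ?subn_gt0 // big_distrl; apply: eq_bigr => v _.
  by rewrite /= -mulrA mulr_suml.
under [RHS]eq_bigr do rewrite exchange_big; rewrite exchange_big /=.
apply: eq_bigr => v _; under [RHS]eq_bigr do rewrite -mulr_sumr.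
rewrite -mulr_sumr; congr (_ * _).
under [RHS]eq_bigr do rewrite exchange_big.
(* [T b m] collects the spines that enter a child of size [b] and end at a node of size [m]. *)
pose T b m := \sum_(w < s) (ctx (b - m) (l v) w * P (n - b) (r v)
     + P (n - b) (l v) * ctx (b - m) (r v) w) * Y m w.
transitivity (\sum_(b < n | (h < b)%N) \sum_(m < b.+1 | (h < m)%N) T b m); last first.
  rewrite exchange_triangle; apply: eq_bigr => m _; apply: eq_bigr => b _.
  by apply: eq_bigr => w _; rewrite addnK (addnC b) subnDA.
apply: eq_bigr => b hb; have lt_bn := ltn_ord b.
rewrite !IHn ?hb ?(leq_trans (ltnW lt_bn)) ?l_lt ?r_lt // mulr_suml mulr_sumr -big_split.
apply: eq_bigr => m _; rewrite mulr_suml mulr_sumr -big_split.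
by apply: eq_bigr => w _ /=; ring.
Qed.

Hypothesis P0 : forall u, P 0 u = 0.
Hypothesis PE : forall a u, (1 < a)%N -> (u < s)%N ->
  P a u = \sum_(v < s) L u v * \sum_(b < a) P b (l v) * P (a - b) (r v).

(** For a context the spine follows the child with the hole, and sizes are measured outside the
    hole; that child is always unique. *)
Lemma ctx_spine h n u w : (h < n)%N -> (u < s)%N ->
  ctx n u w = \sum_(m < n.+1 | (h < m)%N) \sum_(v < s) ctx (n - m) u v *
    \sum_(b < m | (b <= h)%N)
      (ctx b (l v) w * P (m - b) (r v) + P (m - b) (l v) * ctx b (r v) w).
Proof.
move=> hn us; apply: (@spine_decomposition (fun n u => ctx n u w) (fun m v => \sum_(b < m | (b <= h)%N)
  (ctx b (l v) w * P (m - b) (r v) + P (m - b) (l v) * ctx b (r v) w)) h n).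
- move=> {hn us u}{}n u /andP[hn _] us; rewrite ctxE 1?(leq_trans _ hn) //.
  apply: eq_bigr => v _; congr (_ * _).
  rewrite (bigID (fun b : 'I_n => (b <= h)%N)) /=; congr (_ + _).
  by apply: eq_bigl => b; rewrite -ltnNge.
- by rewrite hn leqnn.
- by [].
Qed.

(** The bound [n <= h + h] ensures that at most one child has size [> h], so the spine is well
    defined. *)
Lemma deriv_spine h n u : (0 < h)%N -> (h < n)%N -> (n <= h + h)%N -> (u < s)%N ->
  P n u = \sum_(m < n.+1 | (h < m)%N) \sum_(v < s) ctx (n - m) u v *
    \sum_(b < m | (b <= h)%N && (m - b <= h)%N) P b (l v) * P (m - b) (r v).
Proof.
move=> h0 hn n2h us; apply: (@spine_decomposition P (fun m v =>
  \sum_(b < m | (b <= h)%N && (m - b <= h)%N) P b (l v) * P (m - b) (r v)) h (h + h)).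
- move=> {hn us u n2h}{}n u /andP[hn n2h] us; rewrite PE ?(leq_trans _ hn) //.
  apply: eq_bigr => v _; congr (_ * _).
  rewrite big_split /= addrA addrAC.
  (* Reflection of [b] into [n - b]. The summand [b = 0] on the right has no partner, but it
     vanishes by [P0]. *)
  have -> : \sum_(b < n | (h < b)%N) P (n - b) (l v) * P b (r v) =
            \sum_(b < n | (h < n - b)%N) P b (l v) * P (n - b) (r v).
    have n0 : (0 < n)%N by apply: leq_ltn_trans hn.
    pose F b := P b (l v) * P (n - b) (r v).
    transitivity (\sum_(1 <= b < n | (h < b)%N) P (n - b) (l v) * P b (r v)).
      rewrite big_geq_mkord; apply: eq_bigl => b; rewrite /= andb_idr // => hb.
      by apply: leq_ltn_trans hb.
    rewrite big_nat_rev /= [RHS](_ : _ = \sum_(1 <= b < n | (h < n - b)%N) F b); last first.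
      rewrite big_geq_mkord /= [LHS]big_mkcond [RHS]big_mkcond /=; apply: eq_bigr => b _.
      by rewrite /F; case: (nat_of_ord b) => [|b']; rewrite ?P0 ?mul0r ?if_same ?andbT.
    rewrite [LHS]big_nat_cond [RHS]big_nat_cond; apply: eq_big => [b|b].
      by apply: andb_id2l => /andP[b0 bn]; rewrite add1n subSS.
    by move=> /andP[/andP[b0 bn] _]; rewrite add1n subSS subKn // ltnW.
  rewrite [LHS](bigID (fun b : 'I_n => (h < b)%N)) /=.
  rewrite addrC; congr (_ + _).
  rewrite (bigID (fun b : 'I_n => (h < n - b)%N)) /= addrC; congr (_ + _).
    by apply: eq_bigl => b; rewrite -!leqNgt.
  by apply: eq_bigl => b; have := ltn_ord b; lia.
- by rewrite hn.
- by [].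
Qed.

Variables (base : R -> Prop) (G : seq R) (N D : nat) (x : nat -> R).
Hypothesis P1 : forall u, (u < s)%N -> P 1 u = \sum_(v < s) L u v * x v.
Hypotheses (base1 : base 1) (baseL : forall u v, base (L u v)) (basex : forall v, base (x v)).
Hypotheses (G1 : 1 \in G).
Hypothesis GL : forall u v, (u < s)%N -> (v < s)%N -> L u v \in G.
Hypothesis Gx : forall v, (v < s)%N -> x v \in G.
Hypothesis GP : forall a u, (a <= D)%N -> (u < s)%N -> P a u \in G.
Hypothesis Gctx : forall c u w, (c <= D)%N -> (u < s)%N -> (w < s)%N -> ctx c u w \in G.
Hypotheses (N_gt0 : (0 < N)%N) (N_large : (D.+1 * (s * (D * 2)) <= N)%N).

Local Notation lev := (lev base G N).
Local Notation lev_succ := (lev_succ N_gt0 G1 base1).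
Local Notation lev1 := (lev1 N_gt0 G1 base1).

(** As [m > h], the outer context has size [n - m <= h], and the inner one has size [b <= h]; only
    the derivation factor can exceed [h], hence the assumption on derivations up to [n]. The bound
    behind [N] counts the choices of [m], [v], [b] and the side. *)
Lemma ctx_lev_step h n q : (h < n)%N -> (n <= h + h.+1)%N -> (n <= D)%N ->
  (forall c u w, (c <= h)%N -> (u < s)%N -> (w < s)%N -> lev q (ctx c u w)) ->
  (forall a u, (a <= n)%N -> (u < s)%N -> lev q (P a u)) ->
  forall u w, (u < s)%N -> (w < s)%N -> lev q.+1 (ctx n u w).
Proof.
move=> hn n2h nD Hctx HP u w us ws; split; first exact: Gctx.
rewrite (@ctx_spine h) //; apply: (@sum3_leq _ _ (n.+1 * (s * (n * 2)))).
  by apply: leq_trans N_large; rewrite leq_mul ?leq_mul.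
apply: sum3_sum => m hm; apply: sum3_sum => v _; rewrite mulr_sumr.
have mn := ltn_ord m; have vs := ltn_ord v.
apply: (@sum3_leq _ _ (m * 2)); first by rewrite leq_mul2r -ltnS mn orbT.
apply: sum3_sum => b bh; have bm := ltn_ord b; rewrite mulrDr !mulrA.
have Hc1 : lev q (ctx (n - m) u v) by apply: Hctx => //; lia.
by apply: (@sum3D _ _ 1 1); apply: sum3_mul => //; (apply: Hctx || apply: HP);
  rewrite ?l_lt ?r_lt //; lia.
Qed.

Lemma deriv_lev_step h n q : (0 < h)%N -> (h < n)%N -> (n <= h + h)%N -> (n <= D)%N ->
  (forall c u w, (c <= h)%N -> (u < s)%N -> (w < s)%N -> lev q (ctx c u w)) ->
  (forall a u, (a <= h)%N -> (u < s)%N -> lev q (P a u)) ->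
  forall u, (u < s)%N -> lev q.+1 (P n u).
Proof.
move=> h0 hn n2h nD Hctx HP u us; split; first exact: GP.
rewrite (@deriv_spine h) //; apply: (@sum3_leq _ _ (n.+1 * (s * (n * 2)))).
  by apply: leq_trans N_large; rewrite leq_mul ?leq_mul.
apply: sum3_sum => m hm; apply: sum3_sum => v _; rewrite mulr_sumr.
have mn := ltn_ord m; have vs := ltn_ord v.
apply: (@sum3_leq _ _ (m * 1)); first by rewrite leq_mul // -ltnS.
apply: sum3_sum => b /andP[bh mbh]; have bm := ltn_ord b; rewrite mulrA.
have Hc1 : lev q (ctx (n - m) u v) by apply: Hctx => //; lia.
by apply: sum3_mul => //; apply: HP; rewrite ?l_lt ?r_lt //; lia.
Qed.

(** Doubling the size costs two levels: first derivations, from weights of at most half the size,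
    then contexts, whose products involve derivations of the doubled size. *)
Lemma balanced_lev i : (2 ^ i <= D)%N ->
  (forall a u, (a <= 2 ^ i)%N -> (u < s)%N -> lev i.*2.+1 (P a u)) /\
  (forall c u w, (c <= 2 ^ i)%N -> (u < s)%N -> (w < s)%N -> lev i.*2.+2 (ctx c u w)).
Proof.
elim: i => [|i IHi] iD.
  have lP a u : (a <= 1)%N -> (u < s)%N -> lev 1 (P a u).
    move=> a1 us; split; first by rewrite GP // (leq_trans a1).
    case: a a1 => [|[|]] // _; first by rewrite P0; exact: sum3_0.
    rewrite P1 //; apply: (@sum3_leq _ _ (s * 1)).
      by apply: leq_trans N_large; move: iD; rewrite expn0; nia.
    apply: sum3_sum => v _.
    rewrite -[_ * _]mulr1; apply: sum3_mul; [split|split|split] => //; [exact: GL|exact: Gx].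
  split=> // c u w c1 us ws; case: c c1 => [|[|]] // _.
    by do 2![apply: lev_succ]; split; [exact: GL|exact: baseL].
  (* With [h = 0] and [n = 1] only contexts of size 0, that is coefficients [L], are used besides
     derivations of size at most 1. *)
  apply: (@ctx_lev_step 0) => //.
  by move=> c u' w'; rewrite leqn0 => /eqP-> *; apply: lev_succ; split; [exact: GL|exact: baseL].
have i0 : (0 < 2 ^ i)%N by rewrite expn_gt0.
have iiE : (2 ^ i.+1 = 2 ^ i + 2 ^ i)%N by rewrite expnS mul2n addnn.
have [|IHP IHc] := IHi; first by apply: leq_trans iD; rewrite iiE leq_addr.
have lP a u : (a <= 2 ^ i.+1)%N -> (u < s)%N -> lev i.+1.*2.+1 (P a u).
  move=> ai us; rewrite doubleS; have [le_a|lt_a] := leqP a (2 ^ i).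
    by do 2![apply: lev_succ]; apply: IHP.
  apply: (@deriv_lev_step (2 ^ i)); rewrite -?iiE // ?(leq_trans ai) // => a' u' *.
  by apply: lev_succ; apply: IHP.
split=> // c u w ci us ws; rewrite doubleS; have [le_c|lt_c] := leqP c (2 ^ i).
  by do 2![apply: lev_succ]; apply: IHc.
apply: (@ctx_lev_step (2 ^ i)) => //; rewrite ?(leq_trans ci) //; first by lia.
  by move=> c' u' w' *; apply: lev_succ; apply: IHc.
by move=> a u' ac u's; apply: lP => //; apply: leq_trans ci.
Qed.

End Grammar.

(** * The grammar of a circuit *)

Section Circuits.
Variables (F : fieldType) (k : nat).
Implicit Types (C : seq (gate F)) (g : gate F).

Lemma circuit_vals_rcons C g :
  circuit_vals k (rcons C g) = rcons (circuit_vals k C) (gate_val g (circuit_vals k C)).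
Proof. by rewrite /circuit_vals foldl_rcons. Qed.

Lemma size_circuit_vals C : size (circuit_vals k C) = size C.
Proof. by elim/last_ind: C => // C g IHC; rewrite circuit_vals_rcons !size_rcons IHC. Qed.

Lemma nth_circuit_vals g0 C u : (u < size C)%N ->
  nth 0 (circuit_vals k C) u = gate_val (nth g0 C u) (take u (circuit_vals k C)).
Proof.
elim/last_ind: C => // C g IHC; rewrite size_rcons ltnS circuit_vals_rcons => le_u.
rewrite -cats1 takel_cat ?size_circuit_vals // cats1 !nth_rcons size_circuit_vals.
have [lt_u|gt_u|->] := ltngtP u (size C); first exact: IHC.
  by rewrite leqNgt gt_u in le_u.
by rewrite take_oversize // size_circuit_vals.
Qed.

Lemma circuit_outputE C : circuit_output k C = nth 0 (circuit_vals k C) (size C).-1.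
Proof. by rewrite /circuit_output -nth_last size_circuit_vals. Qed.

Definition label_val (a : F + nat) : mpoly F k :=
  match a with inl c => mconst k c | inr j => mvar F k j end.

Definition is_label p := exists a, p = label_val a.

Section GrammarOfCircuit.
Variable C : seq (gate F).
Let s := size C.
Let vals := circuit_vals k C.

(* The symbol [s] is a dummy deriving nothing. *)
Definition gram_children (v : nat) : nat * nat :=
  if nth (Gconst 0) C v is Gmul i j then
    if (i < v)%N && (j < v)%N then (i, j) else (s, s)
  else (s, s).

Definition gram_terminal (v : nat) : mpoly F k :=
  if nth (Gconst 0) C v is Gvar i then mvar F k i else 0.

(** Constant terms are dropped so that both parts of a product have positive size; [gram_row] moves
    the constants into its coefficients. *)
Definition gram_poly (a u : nat) : mpoly F k := if a == 0%N then 0 else hcomp a (nth 0 vals u).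

Local Notation T := (fun a v : nat => if a == 1%N then gram_terminal v else
  \sum_(b < a) gram_poly b (gram_children v).1 * gram_poly (a - b) (gram_children v).2).

Lemma gram_poly_dummy a : gram_poly a s = 0.
Proof. by rewrite /gram_poly nth_default ?hcomp0 ?if_same // size_circuit_vals. Qed.

Lemma gram_children_lt v : (v < s.+1)%N ->
  ((gram_children v).1 < s.+1)%N /\ ((gram_children v).2 < s.+1)%N.
Proof.
rewrite /gram_children; case: nth => //= i j v_s; case: ifP => //= /andP[iv jv].
by split; apply: ltnW; exact: leq_trans v_s.
Qed.

(** Additions add rows. A product of [ci + p'] and [cj + q'], with [p'] and [q'] free of constant
    term, has positive components [ci q' + cj p'], combined from the rows of the operands, plus
    those of [p' q'], which form the production at [u] itself. The row is the same for all degrees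
    [a]. *)
Lemma gram_row u : (u < s)%N -> exists row : nat -> F, forall a, (0 < a)%N ->
  hcomp a (nth 0 vals u) = \sum_(v < s.+1) mconst k (row v) * T a v.
Proof.
elim/ltn_ind: u => u IHu us.
have row0 p : (forall a, (0 < a)%N -> hcomp a p = 0) -> exists row : nat -> F,
    forall a, (0 < a)%N -> hcomp a p = \sum_(v < s.+1) mconst k (row v) * T a v.
  move=> H; exists (fun=> 0) => a a0; rewrite H // big1 // => v _.
  by rewrite rmorph0 mul0r.
have rowi i : exists row : nat -> F, forall a, (0 < a)%N ->
    hcomp a (nth 0 (take u vals) i) = \sum_(v < s.+1) mconst k (row v) * T a v.
  (* A reference to a gate that is not yet computed reads the default 0. *)
  have [iu|ui] := ltnP i u; first by rewrite nth_take //; apply: IHu => //; exact: ltn_trans us.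
  apply: row0 => a _; rewrite nth_default ?hcomp0 // size_takel //.
  by rewrite size_circuit_vals ltnW.
have sumd a : \sum_(v < s.+1) mconst k (v == u :> nat)%:R * T a v = T a u.
  have us1 : (u < s.+1)%N by apply: ltnW.
  rewrite (bigD1 (Ordinal us1)) //= eqxx rmorph1 mul1r -[RHS]addr0.
  congr (_ + _); apply: big1 => v.
  by rewrite -val_eqE /= => /negPf->; rewrite rmorph0 mul0r.
have dum a : \sum_(b < a) gram_poly b s * gram_poly (a - b) s = 0.
  by rewrite big1 // => b _; rewrite gram_poly_dummy mul0r.
rewrite (nth_circuit_vals (Gconst 0)) //; case gE: (nth _ C u) => [i|c|i j|i j] /=.
- exists (fun v => (v == u)%:R) => a a0; rewrite sumd hcomp_mvar.
  by rewrite /gram_terminal /gram_children gE dum.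
- by apply: row0 => a a0; rewrite hcomp_mconst gtn_eqF.
- have [[ri Hi] [rj Hj]] := (rowi i, rowi j); exists (fun v => ri v + rj v) => a a0.
  rewrite hcompD Hi // Hj // -big_split; apply: eq_bigr => v _.
  by rewrite rmorphD mulrDl.
case: (boolP ((i < u)%N && (j < u)%N)) => iju; last first.
  apply: row0 => a _; suff ->: nth 0 (take u vals) i * nth 0 (take u vals) j = 0.
    by rewrite hcomp0.
  have tk n : (u <= n)%N -> nth 0 (take u vals) n = 0.
    by move=> un; rewrite nth_default // size_takel // size_circuit_vals ltnW.
  by case/nandP: iju; rewrite -leqNgt => /tk->; rewrite ?mul0r ?mulr0.
have [[ri Hi] [rj Hj]] := (rowi i, rowi j).
set p := nth 0 _ i in Hi *; set q := nth 0 _ j in Hj *.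
have [[ci Ei] [cj Ej]] := (hcomp0_const p, hcomp0_const q).
exists (fun v => ci * rj v + cj * ri v + (v == u)%:R) => a a0.
transitivity (\sum_(v < s.+1) (mconst k ci * (mconst k (rj v) * T a v)
   + mconst k cj * (mconst k (ri v) * T a v) + mconst k (v == u :> nat)%:R * T a v)); last first.
  by apply: eq_bigr => v _; rewrite !rmorphD !rmorphM /=; ring.
rewrite !big_split /= sumd -!mulr_sumr -Hi // -Hj //.
have /andP[iu ju] := iju.
have qE : gram_children u = (i, j) by rewrite /gram_children gE iju.
have pP b : (0 < b)%N -> gram_poly b i = hcomp b p.
  by rewrite /gram_poly /p nth_take // => /gtn_eqF->.
have qP b : (0 < b)%N -> gram_poly b j = hcomp b q.
  by rewrite /gram_poly /q nth_take // => /gtn_eqF->.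
rewrite hcompM -(big_mkord xpredT (fun b => hcomp b p * hcomp (a - b) q)).
rewrite big_nat_recr //= big_ltn // subn0 subnn Ei Ej qE /=.
rewrite [_ * mconst k cj]mulrC -!addrA; congr (_ + _); rewrite addrC; congr (_ + _).
(* In degree 1 the product of the parts without constant term contributes nothing, matching the zero
   terminal of a multiplication gate. *)
case: eqP => [->|/eqP a1]; first by rewrite big_geq // /gram_terminal gE.
rewrite -(big_mkord xpredT (fun b => gram_poly b i * gram_poly (a - b) j)).
have a2 : (1 < a)%N by rewrite ltn_neqAle eq_sym a1.
rewrite [RHS]big_ltn // {1}/gram_poly eqxx mul0r add0r big_nat_cond [RHS]big_nat_cond.
by apply: eq_bigr => b /andP[/andP[b0 ba] _]; rewrite pP // qP // subn_gt0.
Qed.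

Lemma circuit_grammar : exists L : nat -> nat -> F, forall a u, (0 < a)%N -> (u < s.+1)%N ->
  gram_poly a u = \sum_(v < s.+1) mconst k (L u v) * T a v.
Proof.
have [L HL] : exists L : 'I_s -> nat -> F, forall (u : 'I_s) a, (0 < a)%N ->
    hcomp a (nth 0 vals u) = \sum_(v < s.+1) mconst k (L u v) * T a v.
  by have [L HL] := fin_all_exists (fun u : 'I_s => gram_row (ltn_ord u)); exists L.
exists (fun u v => if insub u is Some u' then L u' v else 0) => a u a0 us.
case: insubP => [u' u'E uE|].
  by rewrite /gram_poly gtn_eqF // -uE HL.
rewrite -leqNgt => su; have -> : u = s by apply/eqP; rewrite eqn_leq su andbT.
by rewrite gram_poly_dummy big1 // => v _; rewrite rmorph0 mul0r.
Qed.

(** [G] collects the weights of derivations and contexts of size at most [D], the coefficients and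
    terminals, and [1], [f] and the constant term of [f]. One level above the derivations, the
    components of [f] are added up. *)
Lemma circuit_lev i (f := circuit_output k C) (D := (2 ^ i)%N)
    (N := (D.+1 * (s.+1 * (D * 2)) + D.+1)%N) : (mdeg f <= D)%N ->
  exists2 G : seq (mpoly F k),
    (size G <= 3 + s.+1 * s.+1 + s.+1 + D.+1 * s.+1 + D.+1 * (s.+1 * s.+1))%N &
    lev is_label G N i.*2.+2 f.
Proof.
move=> degf; have [L HL] := circuit_grammar.
pose l v := (gram_children v).1; pose r v := (gram_children v).2.
pose LL u v := mconst k (L u v).
have [c0 Hc0] := hcomp0_const f.
have [I sI II] : exists2 I, size I = s.+1 & forall u, (u < s.+1)%N -> u \in I.
  by exists (iota 0 s.+1) => [|u]; rewrite ?size_iota ?mem_iota.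
have [J sJ IJ] : exists2 J, size J = D.+1 & forall a, (a <= D)%N -> a \in J.
  by exists (iota 0 D.+1) => [|u]; rewrite ?size_iota ?mem_iota.
pose cx := ctx s.+1 gram_poly LL l r.
pose G := [:: 1; f; mconst k c0] ++ [seq LL u v | u <- I, v <- I] ++ map gram_terminal I
  ++ [seq gram_poly a u | a <- J, u <- I]
  ++ [seq cx c uw.1 uw.2 | c <- J, uw <- [seq (u, w) | u <- I, w <- I]].
have G1 : 1 \in G by rewrite !mem_cat inE eqxx.
have base1 : is_label 1 by exists (inl 1); rewrite /= rmorph1.
have N_gt0 : (0 < N)%N by rewrite addn_gt0 orbT.
exists G.
  by rewrite !size_cat !size_allpairs size_map sI sJ !addnA.
have P0 u : gram_poly 0 u = 0 by [].
have GP a u : (a <= D)%N -> (u < s.+1)%N -> gram_poly a u \in G.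
  move=> aD us; rewrite !mem_cat; apply/orP; right; apply/orP; right; apply/orP; right.
  by apply/orP; left; apply: (allpairs_f gram_poly); [exact: IJ | exact: II].
have Gx v : (v < s.+1)%N -> gram_terminal v \in G.
  by move=> vs; rewrite !mem_cat; do 2![apply/orP; right]; rewrite map_f ?II.
have GL u v : (u < s.+1)%N -> (v < s.+1)%N -> LL u v \in G.
  by move=> us vs; rewrite !mem_cat; apply/orP; right; rewrite (allpairs_f LL) ?II.
have Gctx c u w : (c <= D)%N -> (u < s.+1)%N -> (w < s.+1)%N -> cx c u w \in G.
  move=> cD us ws; rewrite !mem_cat; do 4![apply/orP; right].
  exact: (allpairs_f (fun c uw => cx c uw.1 uw.2) (IJ c cD) (allpairs_f pair (II u us) (II w ws))).
have PE a u : (1 < a)%N -> (u < s.+1)%N -> gram_poly a u =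
    \sum_(v < s.+1) LL u v * \sum_(b < a) gram_poly b (l v) * gram_poly (a - b) (r v).
  by move=> a1 us; rewrite HL ?(ltnW a1) // gtn_eqF.
have P1 u : (u < s.+1)%N -> gram_poly 1 u = \sum_(v < s.+1) LL u v * gram_terminal v.
  by move=> us; rewrite HL.
have bL u v : is_label (LL u v) by exists (inl (L u v)).
have bx v : is_label (gram_terminal v).
  rewrite /gram_terminal; case: nth => [j|c|j j'|j j']; first by exists (inr j).
  1-3: by exists (inl 0); rewrite /= rmorph0.
have [HP _] := @balanced_lev _ s.+1 gram_poly LL l r (fun v vs => (gram_children_lt vs).1)
  (fun v vs => (gram_children_lt vs).2) P0 PE is_label G N D
  gram_terminal P1 base1 bL bx G1 GL Gx GP Gctx N_gt0 (leq_addr _ _) i (leqnn _).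
split; first by rewrite !mem_cat !inE eqxx orbT.
(* The last summand [D.+1] of [N] makes room for this sum. *)
rewrite [f](hcomp_sum degf); apply: (@sum3_leq _ _ (D.+1 * 1)).
  by rewrite muln1 leq_addl.
apply: sum3_sum => a _; rewrite -[hcomp a f]mulr1 -[_ * 1]mulr1.
have l1 := @lev1 _ is_label _ _ N_gt0 G1 base1; apply: sum3_mul => //.
(* Components of positive degree belong to the output gate; the constant one is a label and is
   present at every level. *)
case: a => [[|a] aD]; last first.
  have := HP a.+1 s.-1 aD; rewrite {1}/gram_poly -circuit_outputE; apply.
  by rewrite ltnS leq_pred.
suff: forall q, lev is_label G N q (hcomp 0 f) by apply.
elim=> [|q IHq]; last exact: (@lev_succ _ is_label G N q _ N_gt0 G1 base1 IHq).
by rewrite Hc0; split; [rewrite !mem_cat !inE eqxx !orbT | exists (inl c0)].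
Qed.

End GrammarOfCircuit.
End Circuits.

(** * Tree queries *)

Section TreeSums.
Variables (R : comNzRingType) (D : finType) (n : nat) (par : nat -> nat).
Hypothesis par_lt : forall j, (0 < j)%N -> (par j < j)%N.
Variables (w : D -> R) (rel : nat -> D -> D -> bool) (H : nat -> D -> R).
Hypothesis HE : forall i x, (i < n)%N ->
  H i x = w x * \prod_(j < n | (0 < j)%N && (par j == i)) \sum_(y | rel j x y) H j y.

Definition tree_hom m (a : {ffun 'I_m.+1 -> D}) :=
  [forall j : 'I_m.+1, (0 < j)%N ==> rel j (a (inord (par j))) (a j)].

(** The factor of node [i] once all nodes beyond [m] have been summed out: every removed child [j]
    leaves its full subtree sum. *)
Definition pruned_weight (m i : nat) (x : D) : R :=
  w x * \prod_(j < n | (m < j)%N && (par j == i)) \sum_(y | rel j x y) H j y.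

Definition ffun_rcons m (p : {ffun 'I_m.+1 -> D} * D) : {ffun 'I_m.+2 -> D} :=
  [ffun i => if unlift ord_max i is Some j then p.1 j else p.2].

Definition ffun_belast m (a : {ffun 'I_m.+2 -> D}) : {ffun 'I_m.+1 -> D} * D :=
  ([ffun i => a (lift ord_max i)], a ord_max).

Lemma ffun_rconsK m : cancel (@ffun_rcons m) (@ffun_belast m).
Proof.
case=> b y; congr (_, _); last by rewrite ffunE unlift_none.
by apply/ffunP => i; rewrite !ffunE liftK.
Qed.

Lemma ffun_belastK m : cancel (@ffun_belast m) (@ffun_rcons m).
Proof.
move=> a; apply/ffunP => i; rewrite ffunE; case: unliftP => [j|] -> //.
by rewrite ffunE.
Qed.

Lemma ffun_rcons_small m p (i : nat) : (i < m.+1)%N -> @ffun_rcons m p (inord i) = p.1 (inord i).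
Proof.
move=> im; rewrite ffunE; case: unliftP => [j /(congr1 val)|/(congr1 val)] /=.
  rewrite inordK; last exact: ltnW.
  by rewrite /bump leqNgt ltn_ord add0n => ->; rewrite inord_val.
by rewrite inordK; [move=> ei; rewrite ei ltnn in im | exact: ltnW].
Qed.

Lemma ffun_rcons_last m p : @ffun_rcons m p ord_max = p.2.
Proof. by rewrite ffunE unlift_none. Qed.

(** Parents have smaller indices, so [m.+1] is a leaf among the nodes up to [m.+1]; summing over its
    image leaves a factor at its parent. *)
Lemma prune_leaf m : (m.+1 < n)%N ->
  \sum_(a : {ffun 'I_m.+2 -> D} | tree_hom a) \prod_(i < m.+2) pruned_weight m.+1 i (a i) =
  \sum_(a : {ffun 'I_m.+1 -> D} | tree_hom a) \prod_(i < m.+1) pruned_weight m i (a i).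
Proof.
move=> mn; have pm : (par m.+1 < m.+1)%N by apply: par_lt.
rewrite (reindex (@ffun_rcons m)) /=; last first.
  by exists (@ffun_belast m) => a _; rewrite (ffun_rconsK, ffun_belastK).
pose r' (b : {ffun 'I_m.+1 -> D}) y := rel m.+1 (b (inord (par m.+1))) y.
have widenE (i : 'I_m.+1) : widen_ord (leqnSn m.+1) i = inord i.
  by apply: val_inj; rewrite /= inordK //; apply: ltn_trans (ltn_ord i) _.
transitivity (\sum_(p | tree_hom p.1 && r' p.1 p.2)
    (\prod_(i < m.+1) pruned_weight m.+1 i (p.1 i)) * pruned_weight m.+1 m.+1 p.2).
  apply: eq_big => [p|p _]; last first.
    rewrite big_ord_recr /= ffun_rcons_last; congr (_ * _); apply: eq_bigr => i _.
    by rewrite widenE ffun_rcons_small // inord_val.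
  apply/forallP/andP => [Hp|[/forallP Hp rp] j].
    split; last by have := Hp ord_max; rewrite /= ffun_rcons_last ffun_rcons_small.
    apply/forallP => j; apply/implyP => j0.
    have pj := ltn_trans (par_lt j0) (ltn_ord j); have := Hp (widen_ord (leqnSn _) j).
    rewrite /= j0 widenE ffun_rcons_small // ffun_rcons_small ?inord_val //.
  apply/implyP => j0; have [jm|jm] := ltnP j m.+1.
    have pj := ltn_trans (par_lt j0) jm; have := Hp (Ordinal jm); rewrite /= j0 /=.
    have -> : Ordinal jm = inord j by apply: val_inj; rewrite /= inordK.
    rewrite -[X in _ -> rel _ _ (ffun_rcons p X)]inord_val !ffun_rcons_small //.
  have -> : j = ord_max by apply: val_inj; apply/eqP; rewrite eqn_leq jm -ltnS ltn_ord.
  by rewrite ffun_rcons_last ffun_rcons_small.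
rewrite -(pair_big_dep (@tree_hom m) r' (fun b y =>
  (\prod_(i < m.+1) pruned_weight m.+1 i (b i)) * pruned_weight m.+1 m.+1 y)) /=.
apply: eq_bigr => b _; rewrite -mulr_sumr.
(* All children of [m.+1] lie beyond it, so its pruned weight is already [H m.+1]. *)
have -> : \sum_(y | r' b y) pruned_weight m.+1 m.+1 y = \sum_(y | r' b y) H m.+1 y.
  apply: eq_bigr => y _; rewrite HE //; congr (_ * _); apply: eq_bigl => j.
  apply: andb_id2r => /eqP pj; case: (posnP j) => [->|j0] //.
  by rewrite -pj par_lt.
pose i0 : 'I_m.+1 := inord (par m.+1).
have i0E : i0 = par m.+1 :> nat by rewrite inordK.
(* The sum over the leaf is distributed over the product: it is attached to the parent [i0], and 1
   to the other nodes. *)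
rewrite [LHS](_ : _ = \prod_(i < m.+1) (pruned_weight m.+1 i (b i) *
    if i == i0 then \sum_(y | rel m.+1 (b i) y) H m.+1 y else 1)); last first.
  have E : \prod_(i < m.+1) (if i == i0 then \sum_(y | rel m.+1 (b i) y) H m.+1 y else 1)
      = \sum_(y | r' b y) H m.+1 y.
    by rewrite (bigD1 i0) //= eqxx [X in _ * X]big1 ?mulr1 // => i /negPf->.
  by rewrite -E -big_split.
apply: eq_bigr => i _; rewrite /pruned_weight -mulrA; congr (_ * _); rewrite mulrC.
rewrite [RHS](bigID (fun j : 'I_n => j == m.+1 :> nat)) /=; congr (_ * _); last first.
  by apply: eq_bigl => j; case: (par j == i); rewrite ?andbF ?andbT //; lia.
have mnE (j : 'I_n) : (j == m.+1 :> nat) = (j == Ordinal mn) by [].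
case: eqP => [->|ne].
  rewrite (big_pred1 (Ordinal mn)) // => j; rewrite mnE /=.
  by case: (eqVneq j (Ordinal mn)) => [->|_]; rewrite ?andbF // /= ltnS leqnn i0E eqxx.
rewrite big_pred0 // => j; rewrite mnE.
case: (eqVneq j (Ordinal mn)) => [->|_]; rewrite ?andbF // andbT /=.
apply/negbTE/nandP; right; apply/eqP => pmi; apply: ne; apply: val_inj.
by rewrite /= inordK.
Qed.

Lemma tree_sum m : n = m.+1 ->
  \sum_(a : {ffun 'I_m.+1 -> D} | tree_hom a) \prod_i w (a i) = \sum_x H 0 x.
Proof.
move=> nE; transitivity (\sum_(a : {ffun 'I_m.+1 -> D} | tree_hom a)
    \prod_(i < m.+1) pruned_weight m i (a i)).
  apply: eq_bigr => a _; apply: eq_bigr => i _; rewrite /pruned_weight big_pred0 ?mulr1 // => j.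
  by have := ltn_ord j; rewrite [X in (_ < X)%N]nE ltnS leqNgt => /negPf->.
have: (m < n)%N by rewrite nE.
elim: m {nE} => [|m IHm] mn; last by rewrite prune_leaf // IHm // ltnW.
rewrite (reindex (fun x : D => [ffun _ : 'I_1 => x])) /=; last first.
  exists (fun a : {ffun 'I_1 -> D} => a ord0) => [x _|a _]; first by rewrite ffunE.
  by apply/ffunP => i; rewrite ffunE (ord1 i).
apply: eq_big => [x|x _]; first by apply/forallP => i; rewrite (ord1 i).
by rewrite big_ord1 ffunE HE.
Qed.

End TreeSums.

Lemma cqQ_quantifier_free (F : fieldType) (P : CQ) : quantifier_free P ->
  cqQ F P = \sum_(b | @cq_sat P b) \prod_i mvar F (cq_dom P) (b i).
Proof.
move=> qf; have xT x : x \in cq_free P by rewrite qf inE.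
pose ext (b : {ffun 'I_(cq_nv P) -> 'I_(cq_dom P)}) : {ffun fvar P -> 'I_(cq_dom P)} :=
  [ffun x => b (val x)].
rewrite /cqQ (reindex ext) /=; last first.
  exists (fun a : {ffun fvar P -> _} => [ffun x => a (Sub x (xT x))]) => [b _|a _].
    by apply/ffunP => x; rewrite !ffunE SubK.
  by apply/ffunP => x; rewrite !ffunE; congr (a _); apply: val_inj.
apply: eq_big => [b|b _].
  apply/existsP/idP => [[c /andP[sc /forallP cE]]|sb]; last first.
    by exists b; rewrite sb; apply/forallP => x; rewrite ffunE.
  suff -> : b = c by [].
  by apply/ffunP => x; have /eqP := cE (Sub x (xT x)); rewrite ffunE SubK.
rewrite (reindex (fun x : 'I_(cq_nv P) => Sub x (xT x) : fvar P)) /=; last first.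
  by exists val => x _; [exact: SubK | apply: val_inj].
by apply: eq_bigr => x _; rewrite ffunE SubK.
Qed.

(** * The query of a rooted tree *)

Section TreeQuery.
Variables (m d : nat) (par : nat -> nat) (rel : nat -> 'I_d -> 'I_d -> bool).
Hypothesis par_lt : forall j, (0 < j)%N -> (par j < j)%N.

(** Each tree edge has a relation of its own; number [j] belongs to the edge from [j.+1] to its
    parent. *)
Definition tree_cq : CQ := @mkCQ d m.+1 setT
  [seq (2%N, [seq [:: p.1; p.2] | p <- enum {: 'I_d * 'I_d} & rel j.+1 p.1 p.2]) | j <- iota 0 m]
  [seq (j, [:: inord (par j.+1); inord j.+1]) | j <- iota 0 m].

Lemma tree_cq_wf : cq_wf tree_cq.
Proof.
apply/andP; split; apply/allP => x /mapP[j]; rewrite mem_iota add0n => jm -> /=.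
  by apply/allP => t /mapP[p _ ->].
by rewrite size_map size_iota (andP jm).2 (nth_map 0%N) // size_iota.
Qed.

Lemma tree_cq_size : (cq_size tree_cq <= d + m.+1 + m * 3 + m * (3 + d * d * 2))%N.
Proof.
rewrite /cq_size /=.
have bnd (T : eqType) (s : seq T) (f : T -> nat) c :
    (forall x, x \in s -> f x <= c)%N -> (sumn (map f s) <= size s * c)%N.
  elim: s => //= x s IHs H; rewrite mulSn leq_add ?H ?mem_head // IHs // => y ys.
  by rewrite H // inE ys orbT.
apply: leq_add.
  rewrite leq_add2l -map_comp -[X in (_ <= X * _)%N](size_iota 0).
  exact: bnd.
rewrite -map_comp -[X in (_ <= X * _)%N](size_iota 0); apply: (bnd nat) => j _ /=.
rewrite -map_comp -addSn leq_add //.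
apply: leq_trans (bnd _ _ _ 2%N _) _ => //; rewrite leq_mul2r /=.
rewrite size_filter; apply: leq_trans (count_size _ _) _.
by rewrite -cardE card_prod !card_ord.
Qed.

Lemma tree_cq_sat b : @cq_sat tree_cq b = tree_hom par rel b.
Proof.
apply/allP/forallP => [H [[|j] jm]|H x /mapP[j]] /=; first by [].
  have xin : (j, [:: inord (par j.+1); inord j.+1]) \in cq_atoms tree_cq.
    by apply/mapP; exists j; rewrite ?mem_iota.
  have /= := H _ xin; rewrite (nth_map 0%N) ?size_iota // nth_iota // add0n.
  case/mapP => -[p1 p2]; rewrite mem_filter /= => /andP[rp _] [-> E2].
  suff -> : Ordinal jm = inord j.+1 by rewrite E2.
  by apply: val_inj; rewrite /= inordK.
rewrite mem_iota add0n => /= jm -> /=; rewrite (nth_map 0%N) ?size_iota // nth_iota // add0n.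
have := H (inord j.+1); rewrite inordK // => /= rb.
apply/mapP; exists (b (inord (par j.+1)), b (inord j.+1)) => //.
by rewrite mem_filter rb mem_enum.
Qed.

Lemma tree_cq_edgeP e : reflect
  (exists2 j, (j < m)%N & e = [set inord (par j.+1); inord j.+1]) (e \in cq_edges tree_cq).
Proof.
have setE j : [set x in [:: inord (par j.+1); inord j.+1]] =
    [set inord (par j.+1); inord j.+1] :> {set 'I_m.+1}.
  by apply/setP => x; rewrite !inE.
rewrite inE -map_comp; apply: (iffP mapP) => [[j]|[j jm ->]].
  by rewrite mem_iota => /= jm ->; exists j; rewrite ?setE.
by exists j; rewrite ?mem_iota //= setE.
Qed.

Lemma tree_cq_adj x y :
  graph_adj (cq_edges tree_cq) x y =
  ((0 < y)%N && (x == par y :> nat)) || ((0 < x)%N && (y == par x :> nat)).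
Proof.
apply/existsP/idP => [[e /and4P[/tree_cq_edgeP[j jm ->]]]|].
  have jE : (inord j.+1 : 'I_m.+1) = j.+1 :> nat by rewrite inordK.
  have pj : (inord (par j.+1) : 'I_m.+1) = par j.+1 :> nat.
    by rewrite inordK // (leq_trans (par_lt _)) // ltnW.
  rewrite !inE => /orP[]/eqP-> /orP[]/eqP-> xy; first by rewrite eqxx in xy.
  - by rewrite jE pj eqxx.
  - by rewrite jE pj eqxx orbT.
  by rewrite eqxx in xy.
have adjP (u v : 'I_m.+1) : (0 < v)%N -> u == par v :> nat ->
    exists2 e, e \in cq_edges tree_cq & [/\ u \in e, v \in e & u != v].
  case: v => [[|j] jm] // _ /eqP /= uE; exists [set inord (par j.+1); inord j.+1].
    by apply/tree_cq_edgeP; exists j.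
  have -> : Ordinal jm = inord j.+1 by apply: val_inj; rewrite /= inordK.
  rewrite -uE inord_val !inE !eqxx orbT; split=> //.
  by apply/eqP => /(congr1 val); rewrite /= inordK // => E; have := @par_lt j.+1 isT;
    rewrite -uE E ltnn.
case/orP => /andP[v0 /(adjP _ _ v0)[e ee [ue ve uv]]]; exists e; rewrite ee ue ve //.
by rewrite eq_sym.
Qed.

Lemma tree_cq_tree : hyp_is_tree (cq_edges tree_cq).
Proof.
have symA : symmetric (graph_adj (cq_edges tree_cq)).
  by move=> x y; rewrite !tree_cq_adj orbC.
split.
- move=> e /tree_cq_edgeP[j jm ->]; rewrite cards2.
  suff -> : (inord (par j.+1) : 'I_m.+1) != inord j.+1 by [].
  apply/eqP => /(congr1 val); have := @par_lt j.+1 isT => pj.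
  by rewrite /= !inordK //; [move=> E; rewrite E ltnn in pj | rewrite (leq_trans pj) // ltnW].
- by rewrite card_ord.
- have conn0 x : connect (graph_adj (cq_edges tree_cq)) x ord0.
    have [N] := ubnP (x : nat); elim: N x => // N IHN x xN.
    case: (posnP x) => [x0|x0]; first by rewrite (_ : x = ord0) //; apply: val_inj.
    have px := par_lt x0; have pm : (par x < m.+1)%N by apply: ltn_trans (ltn_ord x).
    apply: (connect_trans (connect1 _) (IHN (Ordinal pm) _)); last exact: leq_trans px _.
    by rewrite tree_cq_adj x0 /= eqxx orbT.
  move=> x y; apply: connect_trans (conn0 x) _.
  by rewrite (sym_connect_sym symA) conn0.
move=> s us s2; apply/negP => cs.
have [x0 x0s] : exists x0, x0 \in s by case: s s2 {us cs} => // x0 s _; exists x0; rewrite mem_head.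
(* Both neighbours of the largest vertex of a cycle are smaller than it, hence equal to its parent,
   against uniqueness. *)
case: (@arg_maxnP _ x0 [in s] (@nat_of_ord m.+1) x0s) => x /= xs xmax.
have [i s' rE] := rot_to xs.
have nb y : y \in s -> graph_adj (cq_edges tree_cq) x y -> y = par x :> nat.
  move=> /xmax yx; rewrite tree_cq_adj => /orP[]/andP[y0 /eqP E] //.
  by have := par_lt y0; rewrite -E ltnNge yx.
move: cs us s2; rewrite -(rot_cycle i) -(rot_uniq i) -(size_rot i) rE.
have ss y : y \in x :: s' -> y \in s by rewrite -rE mem_rot.
case: s' rE ss => [|y s'] // _ ss; rewrite /= rcons_path => /and3P[xy _ lx].
case/lastP: s' ss lx => [|s' z] // ss; rewrite last_rcons symA => xz /and3P[_ + _] _.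
have yE := nb y (ss y _) xy; have zE := nb z (ss z _) xz.
have -> : y = z by apply: val_inj; rewrite /= yE ?zE // !inE ?mem_rcons !inE eqxx ?orbT.
by rewrite mem_rcons mem_head.
Qed.

Definition label_subst (F : fieldType) (lab : 'I_d -> F + nat) (i : nat) : F + nat :=
  if insub i is Some x then lab x else inl 0.

Lemma tree_cq_projection (F : fieldType) k (lab : 'I_d -> F + nat) :
  projection_of (\sum_(a : {ffun 'I_m.+1 -> 'I_d} | tree_hom par rel a) \prod_i label_val k (lab (a i)))
    (cqQ F tree_cq).
Proof.
exists (label_subst lab); rewrite cqQ_quantifier_free // rmorph_sum.
apply: eq_big => [a|a _]; first by rewrite tree_cq_sat.
rewrite rmorph_prod; apply: eq_bigr => i _.
by rewrite /= meval_mvar // /label_subst valK; case: (lab _).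
Qed.

End TreeQuery.

Lemma functional_choice (A B : Type) (P : A -> B -> Prop) :
  (forall x, exists y, P x y) -> exists f, forall x, P x (f x).
Proof.
move=> H; exists (fun x => sval (constructive_indefinite_description _ (H x))) => x.
exact: svalP.
Qed.

(** * Unfolding levels along the complete ternary tree *)

Fixpoint heap_size q := if q is q'.+1 then (3 * heap_size q').+1 else 0%N.

Lemma heap_size_leq q q' : (q <= q')%N -> (heap_size q <= heap_size q')%N.
Proof.
move=> /subnK <-; elim: (q' - q)%N => // d IHd; rewrite addSn /=; lia.
Qed.

(** Heap numbering: the children of [i] are [3 i + 1], [3 i + 2] and [3 i + 3], and [heap_size e]
    nodes lie above depth [e]. *)
Definition heap_parent j := (j.-1 %/ 3)%N.

Lemma heap_parent_lt j : (0 < j)%N -> (heap_parent j < j)%N.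
Proof. rewrite /heap_parent; lia. Qed.

Definition heap_level e j := (heap_size e <= j < heap_size e.+1)%N.

Section UnfoldLevels.
Variables (F : fieldType) (k : nat) (G : seq (mpoly F k)) (N l : nat) (f : mpoly F k).
Hypotheses (N_gt0 : (0 < N)%N) (l_gt0 : (0 < l)%N).
Local Notation lev := (lev (@is_label F k) G N).
Hypothesis lev_f : lev l f.
Local Notation triple := (mpoly F k * mpoly F k * mpoly F k)%type.
Variables (ts : nat -> nat -> seq triple) (label : nat -> F + nat).
Hypothesis size_ts : forall q i, (size (ts q i) <= N)%N.
Hypothesis lev_ts : forall q i t, t \in ts q i -> [/\ lev q t.1.1, lev q t.1.2 & lev q t.2].
Hypothesis sum_ts : forall q i, lev q.+1 G`_i ->
  G`_i = \sum_(t <- ts q i) t.1.1 * t.1.2 * t.2.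
Hypothesis labelE : forall i, is_label G`_i -> G`_i = label_val k (label i).

(* A domain element is a depth in the tree, the index in [G] of the polynomial produced there,
   and the index of one of its terms. *)
Local Notation state := (('I_l.+1 * 'I_(size G)) * 'I_N)%type.

Definition state_term (x : state) : triple :=
  nth (0, 0, 0) (ts (l - x.1.1).-1 x.1.2) x.2.

Definition state_child (x : state) t : mpoly F k :=
  match t with 0 => (state_term x).1.1 | 1 => (state_term x).1.2 | _ => (state_term x).2 end.

(** A leaf carries its polynomial on term index 0 only, so that it is counted once; an inner state
    only records whether its term index is valid. *)
Definition state_label (x : state) : F + nat :=
  if (x.1.1 : nat) == l then if (x.2 : nat) == 0%N then label x.1.2 else inl 0
  else if (x.2 < size (ts (l - x.1.1).-1 x.1.2))%N then inl 1 else inl 0.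

Definition state_ok i (x : state) :=
  heap_level x.1.1 i && ((i == 0%N) ==> (x.1.2 == index f G :> nat)).

Definition state_rel j (x y : state) :=
  [&& state_ok (heap_parent j) x, y.1.1 == x.1.1.+1 :> nat &
      y.1.2 == index (state_child x (j.-1 %% 3)) G :> nat].

(** Closed form of the subtree sums of [tree_sum]: below an admissible inner state each child
    subtree sums to the factor assigned to it. *)
Definition state_weight (i : nat) (x : state) : mpoly F k :=
  if (heap_size l <= i)%N then label_val k (state_label x) else
  if state_ok i x then label_val k (state_label x) *
    (state_child x 0 * state_child x 1 * state_child x 2)
  else 0.

Lemma sum_states (V : nmodType) e p (e_l : (e <= l)%N) (pG : p \in G) (X : state -> V) :
  \sum_(y : state | (y.1.1 == e :> nat) && (y.1.2 == index p G :> nat)) X y =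
  \sum_(j < N) X ((Ordinal (e_l : (e < l.+1)%N), Ordinal (etrans (index_mem p G) pG)), j).
Proof.
set c := (_, _); transitivity (\sum_(c' | c' == c) \sum_(j < N) X (c', j));
  last by rewrite big_pred1_eq.
rewrite (pair_big_dep (pred1 c) (fun _ _ => true) (fun c j => X (c, j))) /=.
by apply: eq_big => [[[a b] j]|[a j]] //=; rewrite andbT.
Qed.

(** At an inner node the sum over the term index is the decomposition of [p], indices beyond its end
    having label 0; at a leaf only index 0 contributes. *)
Lemma state_weight_sum j e p : (j < heap_size l.+1)%N -> (e <= l)%N -> heap_level e j ->
  (j = 0%N -> p = f) -> lev (l - e) p ->
  \sum_(y : state | (y.1.1 == e :> nat) && (y.1.2 == index p G :> nat)) state_weight j y = p.
Proof.
move=> jn el ej p0 lp; have pG := lev_mem lp; rewrite (sum_states el pG).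
have Gp : G`_(index p G) = p by rewrite nth_index.
have [lj|jl] := leqP (heap_size l) j.
  have el' : e = l.
    apply/eqP; rewrite eqn_leq el leqNgt; apply/negP => /heap_size_leq.
    by case/andP: ej; lia.
  rewrite (bigD1 (Ordinal N_gt0)) //= big1 ?addr0 => [|x].
    rewrite /state_weight lj /state_label /= el' eqxx -labelE Gp //.
    by move: lp; rewrite el' subnn => -[].
  rewrite -val_eqE /= => /negPf x0.
  by rewrite /state_weight lj /state_label /= el' eqxx x0 /= rmorph0.
have el' : (e < l)%N.
  by rewrite ltnNge; apply/negP => /heap_size_leq; case/andP: ej; lia.
have q1 : (l - e = (l - e).-1.+1)%N by rewrite prednK // subn_gt0.
rewrite -[RHS]Gp (@sum_ts (l - e).-1) -?q1 ?Gp // (big_nth (0, 0, 0)) big_mkord.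
set u := ts _ _; rewrite (big_ord_widen _ (fun j => let t := nth (0, 0, 0) u j in
  t.1.1 * t.1.2 * t.2) (size_ts (l - e).-1 (index p G))) /= [RHS]big_mkcond /=.
apply: eq_bigr => x _; rewrite /state_weight leqNgt jl /= /state_ok ej /=.
have -> : (j == 0%N) ==> (index p G == index f G) by apply/implyP => /eqP/p0->.
rewrite /state_label /= ltn_eqF //= -/u; case: ifP => _; last by rewrite /= rmorph0 mul0r.
by rewrite /= rmorph1 mul1r.
Qed.

Lemma state_weightE i x : (i < heap_size l.+1)%N ->
  state_weight i x = label_val k (state_label x) *
    \prod_(j < heap_size l.+1 | (0 < j)%N && (heap_parent j == i))
      \sum_(y | state_rel j x y) state_weight j y.
Proof.
move=> iN; rewrite {1}/state_weight; have [li|il] := leqP (heap_size l) i.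
  (* Children of a node of the last level would have indices beyond the tree. *)
  rewrite big_pred0 ?mulr1 // => j; apply/negbTE/negP => /andP[j0 /eqP ji].
  have jn : (j < (3 * heap_size l).+1)%N := ltn_ord j.
  move: ji li jn j0; rewrite /heap_parent; lia.
have childP t : (t < 3)%N -> (3 * i + t.+1 < heap_size l.+1)%N by move=> /=; lia.
pose ch t (t3 : (t < 3)%N) : 'I_(heap_size l.+1) := Ordinal (childP t t3).
have chE t t3 : heap_parent (ch t t3) = i by rewrite /heap_parent /=; lia.
have prodE (X : 'I_(heap_size l.+1) -> mpoly F k) :
    \prod_(j < heap_size l.+1 | (0 < j)%N && (heap_parent j == i)) X j =
    X (ch 0 isT) * X (ch 1 isT) * X (ch 2 isT).
  rewrite (bigD1 (ch 0 isT)); last by rewrite /= /heap_parent; lia.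
  rewrite (bigD1 (ch 1 isT)); last by rewrite -val_eqE /= /heap_parent; lia.
  rewrite (bigD1 (ch 2 isT)); last by rewrite -!val_eqE /= /heap_parent; lia.
  rewrite big_pred0 /= ?mulr1 ?mulrA // => j; rewrite -!val_eqE /= /heap_parent.
  by apply/negbTE/negP; lia.
rewrite prodE; case: ifP => okx; last first.
  by rewrite [X in _ * (X * _ * _)]big_pred0 ?mul0r ?mulr0 // => y; rewrite /state_rel chE okx.
(* A nonzero label certifies a valid term index, so the three factors do lie on the next lower
   level. *)
have [w0|w0] := eqVneq (label_val k (state_label x)) 0; first by rewrite w0 !mul0r.
have /andP[lx _] := okx.
have xl : (x.1.1 < l)%N.
  by rewrite ltnNge; apply/negP => /heap_size_leq; case/andP: lx; lia.
have tin : state_term x \in ts (l - x.1.1).-1 x.1.2.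
  move: w0; rewrite /state_label ltn_eqF //; case: ifP => [xs _|_]; first exact: mem_nth.
  by rewrite /= rmorph0 eqxx.
have chS t (t3 : (t < 3)%N) : lev (l - x.1.1).-1 (state_child x t) ->
    \sum_(y | state_rel (ch t t3) x y) state_weight (ch t t3) y = state_child x t.
  move=> lc; rewrite -[RHS](@state_weight_sum (ch t t3) x.1.1.+1) //; last by rewrite subnS.
  - apply: eq_bigl => y; rewrite /state_rel chE okx /=.
    by rewrite (_ : _ %% 3 = t)%N //=; lia.
  - by case/andP: lx => h1 h2; rewrite /heap_level /= in h2 *; lia.
  - by rewrite /= addnS.
by have [l0 l1 l2] := lev_ts tin; rewrite !chS.
Qed.

Lemma unfold_levels : exists P : CQ,
  [/\ cq_wf P, quantifier_free P /\ hyp_is_tree (cq_edges P),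
      cq_dom P = (l.+1 * size G * N)%N /\ cq_nv P = heap_size l.+1,
      (cq_size P <= cq_dom P + cq_nv P + cq_nv P * 3 +
         cq_nv P * (3 + cq_dom P * cq_dom P * 2))%N &
      projection_of f (cqQ F P)].
Proof.
pose ev (x : 'I_#|{: state}|) : state := enum_val x.
have evb : bijective ev := enum_val_bij _.
pose rel j (x y : 'I_#|{: state}|) := state_rel j (ev x) (ev y).
pose P := tree_cq (3 * heap_size l) heap_parent rel.
exists P; have cD : #|{: state}| = (l.+1 * size G * N)%N by rewrite !card_prod !card_ord.
split=> //; first exact: tree_cq_wf.
- split=> //; apply: tree_cq_tree; exact: heap_parent_lt.
- apply: leq_trans (tree_cq_size _ _ _) _ => /=; rewrite -!/(heap_size _).
  by rewrite leq_add ?leq_add // leq_mul.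
have -> : f = \sum_(a : {ffun 'I_(3 * heap_size l).+1 -> 'I_#|{: state}|}
    | tree_hom heap_parent rel a) \prod_i label_val k (state_label (ev (a i))).
  rewrite (@tree_sum _ _ (heap_size l.+1) _ heap_parent_lt
    (fun x => label_val k (state_label (ev x))) rel
    (fun i x => state_weight i (ev x)) _ (3 * heap_size l)) //.
    rewrite -(reindex ev (P := xpredT) (F := state_weight 0)) /=;
      last exact: onW_bij evb.
    rewrite -[LHS](@state_weight_sum 0 0) // ?subn0 //.
    rewrite [LHS]big_mkcond; apply: eq_bigr => x _; rewrite /state_weight leqn0.
    (* As the root is not a leaf, its weight vanishes except on states of depth 0 that carry [f]. *)
    have /negPf-> : heap_size l != 0%N by case: l l_gt0.
    rewrite /state_ok /= /heap_level; case: (x.1.1 : nat) => [|e] //=; by case: (_ == index f G).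
  move=> i x iN; rewrite state_weightE //; congr (_ * _); apply: eq_bigr => j _.
  rewrite (reindex ev) //; exact: onW_bij evb.
exact: (@tree_cq_projection (3 * heap_size l) _ heap_parent rel F k (fun x => state_label (ev x))).
Qed.

End UnfoldLevels.

(** Decompositions and labels are only asserted to exist; choice fixes one for each level and index
    in [G]. *)
Lemma lev_projection (F : fieldType) k (G : seq (mpoly F k)) N l f :
  (0 < N)%N -> (0 < l)%N -> lev (@is_label F k) G N l f -> exists P : CQ,
  [/\ cq_wf P, quantifier_free P /\ hyp_is_tree (cq_edges P),
      cq_dom P = (l.+1 * size G * N)%N /\ cq_nv P = heap_size l.+1,
      (cq_size P <= cq_dom P + cq_nv P + cq_nv P * 3 +
         cq_nv P * (3 + cq_dom P * cq_dom P * 2))%N &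
      projection_of f (cqQ F P)].
Proof.
move=> N0 l0 lf; set lv := lev (@is_label F k) G N in lf.
have [ts tsP] : exists ts : nat * nat -> seq (mpoly F k * mpoly F k * mpoly F k), forall qi,
    [/\ (size (ts qi) <= N)%N,
        forall t, t \in ts qi -> [/\ lv qi.1 t.1.1, lv qi.1 t.1.2 & lv qi.1 t.2] &
        lv qi.1.+1 G`_qi.2 -> G`_qi.2 = \sum_(t <- ts qi) t.1.1 * t.1.2 * t.2].
  apply: (@functional_choice _ _ (fun qi ts => [/\ (size ts <= N)%N,
    forall t, t \in ts -> [/\ lv qi.1 t.1.1, lv qi.1 t.1.2 & lv qi.1 t.2] &
    lv qi.1.+1 G`_qi.2 -> G`_qi.2 = \sum_(t <- ts) t.1.1 * t.1.2 * t.2])) => -[q i] /=; case: (classic (lv q.+1 G`_i)) => [|nl].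
    by case=> _ [ts sz [tsA tsE]]; exists ts.
  by exists [::]; split.
have [lab labP] : exists lab : nat -> F + nat, forall i,
    is_label G`_i -> G`_i = label_val k (lab i).
  apply: (@functional_choice _ _ (fun i a => is_label G`_i -> G`_i = label_val k a)) => i; case: (classic (is_label G`_i)) => [[a aE]|nl].
    by exists a.
  by exists (inl 0).
apply: (@unfold_levels _ _ _ _ _ _ N0 l0 lf (fun q i => ts (q, i)) lab) => //.
- by move=> q i; have [] := tsP (q, i).
- by move=> q i; have [_ H _] := tsP (q, i); exact: H.
- by move=> q i; have [_ _ H] := tsP (q, i); exact: H.
Qed.

(** * Polynomial bounds and universality *)

Section PolyBounded.
Local Open Scope nat_scope.

Lemma poly_boundedP s :
  poly_bounded s <-> exists A B, forall n, s n <= A * n.+1 ^ B.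
Proof.
split=> [[c Hc]|[A [B H]]].
  exists c.+1, c => n; apply: leq_trans (Hc n) _; rewrite mulSn leq_add //.
    by case: c {Hc} => // c; rewrite leq_exp2r.
  by rewrite leq_pmulr // expn_gt0.
(* The first summand serves [n <= 1]; for [n >= 2] one has [A <= n ^ A] and [n.+1 <= n ^ 2]. *)
exists (A * 2 ^ B + A + B * 2) => n; apply: leq_trans (H n) _.
have [n1|n2] := leqP n 1.
  apply: leq_trans (leq_addl _ _); rewrite -addnA; apply: leq_trans (leq_addr _ _).
  by rewrite leq_mul2l; apply/orP; right; case: B {H} => [|B] //; rewrite leq_exp2r.
apply: leq_trans (leq_addr _ _); rewrite -addnA addnC expnD.
have n0 : 0 < n by apply: ltnW.
apply: leq_trans (leq_pmulr _ _); last by rewrite expn_gt0 n0.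
rewrite expnD; apply: leq_mul.
  by apply: leq_trans (ltnW (ltn_expl A (ltnSn 1))) _; case: A {H} => // A; rewrite leq_exp2r.
rewrite mulnC expnM; case: B {H} => // B; rewrite leq_exp2r //; nia.
Qed.

Lemma poly_bounded_leq s t : (forall n, s n <= t n) -> poly_bounded t -> poly_bounded s.
Proof. by move=> st [c H]; exists c => n; apply: leq_trans (st n) _. Qed.

Lemma poly_bounded_const c : poly_bounded (fun=> c).
Proof. by exists c => n; rewrite leq_addl. Qed.

Lemma poly_boundedM s t : poly_bounded s -> poly_bounded t -> poly_bounded (fun n => s n * t n).
Proof.
move=> /poly_boundedP[A [B H]] /poly_boundedP[A' [B' H']]; apply/poly_boundedP.
by exists (A * A'), (B + B') => n; rewrite expnD mulnACA leq_mul.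
Qed.

Lemma poly_boundedD s t : poly_bounded s -> poly_bounded t -> poly_bounded (fun n => s n + t n).
Proof.
move=> /poly_boundedP[A [B H]] /poly_boundedP[A' [B' H']]; apply/poly_boundedP.
exists (A + A'), (B + B') => n; rewrite mulnDl leq_add //.
  by apply: leq_trans (H n) _; rewrite leq_mul2l leq_pexp2l ?leq_addr ?orbT.
by apply: leq_trans (H' n) _; rewrite leq_mul2l leq_pexp2l ?leq_addl ?orbT.
Qed.

Lemma poly_boundedS s : poly_bounded s -> poly_bounded (fun n => (s n).+1).
Proof.
move=> ps; apply: poly_bounded_leq (poly_boundedD ps (poly_bounded_const 1)) => n.
by rewrite addn1.
Qed.

Lemma poly_boundedX s c : poly_bounded s -> poly_bounded (fun n => s n ^ c).
Proof.
move=> ps; elim: c => [|c IHc]; first exact: poly_bounded_const.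
by apply: poly_bounded_leq (poly_boundedM ps IHc) => n; rewrite expnS.
Qed.

Lemma heap_size_exp q : heap_size q < 3 ^ q.
Proof. by elim: q => //= q IHq; rewrite expnS; lia. Qed.
End PolyBounded.

Create HintDb poly_bounded.
Hint Resolve poly_bounded_const poly_boundedM poly_boundedD poly_boundedS poly_boundedX : poly_bounded.

Lemma VP_tree_projection (F : fieldType) (k : nat -> nat) (f : forall n, mpoly F (k n)) :
  inVP f ->
  exists Phi : nat -> CQ,
    [/\ forall n, cq_wf (Phi n),
        forall n, quantifier_free (Phi n),
        forall n, hyp_is_tree (cq_edges (Phi n)),
        poly_bounded (fun n => cq_size (Phi n)) &
        p_projection f (fun n => cqQ F (Phi n))].
Proof.
move=> [pdeg [s [ps HC]]].
(* [D] bounds the least power of two above [(mdeg (f n)).+1], and [S] also counts the dummy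
   symbol. *)
pose D n := ((mdeg (f n)).+1 * 2)%N; pose S n := (s n).+1.
pose W n := (3 + S n * S n + S n + (D n).+1 * S n + (D n).+1 * (S n * S n))%N.
pose N n := ((D n).+1 * (S n * (D n * 2)) + (D n).+1)%N.
(* With [2 ^ i <= D n] there are [i.*2.+3] depths, at most [D n * 2 + 3], and fewer than
   [3 ^ (2 i + 3)] nodes, at most [27 * D n ^ 4] because [9 <= 2 ^ 4]. *)
pose dom n := ((D n * 2 + 3) * W n * N n)%N; pose nv n := (27 * D n ^ 4)%N.
pose bound n := (dom n + nv n + nv n * 3 + nv n * (3 + dom n * dom n * 2))%N.
have [Phi HPhi] : exists Phi : nat -> CQ, forall n,
    [/\ cq_wf (Phi n), quantifier_free (Phi n), hyp_is_tree (cq_edges (Phi n)),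
        (cq_size (Phi n) <= bound n)%N & projection_of (f n) (cqQ F (Phi n))].
  apply: (@functional_choice _ _ (fun n P => [/\ cq_wf P, quantifier_free P,
    hyp_is_tree (cq_edges P), (cq_size P <= bound n)%N & projection_of (f n) (cqQ F P)])) => n.
  have [C [Cs Cf]] := HC n; set i := (trunc_log 2 (mdeg (f n)).+1).+1.
  have /andP[i1 i2] := trunc_log_bounds (ltnSn 1) (ltn0Sn (mdeg (f n))); rewrite -/i in i2.
  have iD : (2 ^ i <= D n)%N by rewrite /i expnSr leq_mul2r.
  have [|G GW lG] := @circuit_lev F (k n) C i; first by rewrite Cf; exact: ltnW (ltnW i2).
  rewrite Cf in lG.
  have [P [wfP [qfP treeP] [domP nvP] szP proP]] :=
    lev_projection (ltn_addl _ (ltn0Sn _)) (ltn0Sn _) lG.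
  exists P; split=> //; apply: leq_trans szP _.
  have domB : (cq_dom P <= dom n)%N.
    rewrite domP; apply: leq_mul; first apply: leq_mul.
    - by have := ltn_expl i (ltnSn 1); lia.
    - apply: leq_trans GW _; rewrite /W /S.
      by rewrite !leq_add ?leq_mul ?leq_add ?ltnS.
    - by rewrite /N /S leq_add ?leq_mul ?ltnS.
  have nvB : (cq_nv P <= nv n)%N.
    rewrite nvP; apply: leq_trans (ltnW (heap_size_exp _)) _.
    rewrite (_ : i.*2.+3 = 3 + 2 * i)%N; last by rewrite mul2n.
    rewrite expnD leq_mul //; apply: (@leq_trans ((2 ^ i) ^ 4)); last by rewrite leq_exp2r.
    have -> : ((2 ^ i) ^ 4 = (2 ^ 4) ^ i)%N by rewrite -!expnM mulnC.
    by rewrite expnM; case: (i) => // j; rewrite leq_exp2r.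
  by rewrite !leq_add ?leq_mul ?leq_add ?leq_mul.
exists Phi; split=> [n|n|n||].
- by have [] := HPhi n.
- by have [] := HPhi n.
- by have [] := HPhi n.
- apply: (@poly_bounded_leq _ bound) => [n|]; first by have [] := HPhi n.
  have pD : poly_bounded D by rewrite /D; eauto with poly_bounded.
  have pS : poly_bounded S by rewrite /S; eauto with poly_bounded.
  have pW : poly_bounded W by rewrite /W; auto 20 with poly_bounded.
  have pN : poly_bounded N by rewrite /N; auto 20 with poly_bounded.
  have pd : poly_bounded dom by rewrite /dom; auto 20 with poly_bounded.
  have pn : poly_bounded nv by rewrite /nv; auto 20 with poly_bounded.
  by rewrite /bound; auto 20 with poly_bounded.
- exists 'X; split=> [n|n]; first by rewrite hornerX.
  by rewrite hornerX absz_nat; have [] := HPhi n.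
Qed.

(** * Elimination of bags *)

Section StraightLine.
Variables (F : fieldType) (k : nat).
Implicit Types (l : seq (mpoly F k)) (p q : mpoly F k).

(** A circuit as the list of its values, newest first. Operands are found by membership instead of
    position, which survives extension of the list. *)
Fixpoint straight_line l : Prop :=
  if l is p :: l' then
    straight_line l' /\ [\/ is_label p, (exists2 q, q \in l' & exists2 r, r \in l' & p = q + r)
                       | (exists2 q, q \in l' & exists2 r, r \in l' & p = q * r)]
  else True.

Lemma straight_line_circuit l : straight_line l -> exists C, circuit_vals k C = rev l.
Proof.
elim: l => [|p l IHl] /=; first by exists [::].
case=> /IHl[C CE] st; suff [g gE] : exists g, gate_val g (rev l) = p.
  by exists (rcons C g); rewrite circuit_vals_rcons CE gE rev_cons.
have idx q : q \in l -> nth 0 (rev l) (index q (rev l)) = q.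
  by move=> ql; rewrite nth_index // mem_rev.
case: st => [[[c|j] ->]|[q ql [r rl ->]]|[q ql [r rl ->]]].
- by exists (Gconst c).
- by exists (Gvar F j).
- by exists (Gadd F (index q (rev l)) (index r (rev l))); rewrite /= !idx.
- by exists (Gmul F (index q (rev l)) (index r (rev l))); rewrite /= !idx.
Qed.

Lemma straight_line_output l p : straight_line l -> p \in l ->
  exists2 C : seq (gate F), (size C <= size l)%N & circuit_output k C = p.
Proof.
elim: l => // q l IHl; rewrite inE; have [->|_] /= := eqVneq p q; last first.
  by move=> [sl _] /(IHl sl)[C Cl CE]; exists C; rewrite // ltnW.
move=> sl _; have [C CE] := @straight_line_circuit (q :: l) sl; exists C.
  by rewrite -(size_circuit_vals k) CE size_rev.
by rewrite /circuit_output CE rev_cons last_rcons.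
Qed.

Lemma straight_line_sum (I : Type) (s : seq I) (P : pred I) (f : I -> mpoly F k) l :
  straight_line l -> 0 \in l -> (forall i, P i -> f i \in l) ->
  exists2 l', straight_line l' /\ {subset l <= l'} &
    (size l' <= size l + size s)%N /\ \sum_(i <- s | P i) f i \in l'.
Proof.
move=> sl l0 fl; elim: s => [|i s [l' [sl' ll'] [sz Sl']]].
  by exists l => //; split; rewrite ?big_nil ?addn0.
rewrite big_cons; case: ifP => [Pi|_]; last first.
  by exists l' => //; split=> //; rewrite /= addnS ltnW.
exists ((f i + \sum_(j <- s | P j) f j) :: l').
  split=> [|q ql]; last by rewrite inE ll' ?orbT.
  split=> //; apply: Or32; exists (f i); first by apply/ll'/fl.
  by exists (\sum_(j <- s | P j) f j).
by split; rewrite ?mem_head //= addnS ltnS.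
Qed.

End StraightLine.

Section Restriction.
Variables (V D : finType) (d0 : D).
Implicit Types (a b c : {ffun V -> D}) (U W B : {set V}).

(** A partial assignment on [U] is encoded as a total one with value [d0] outside, that is as a
    fixed point of [restr U]. *)
Definition restr U a : {ffun V -> D} := [ffun v => if v \in U then a v else d0].

Lemma restr_restr U W a : U \subset W -> restr U (restr W a) = restr U a.
Proof.
by move=> /subsetP UW; apply/ffunP => v; rewrite !ffunE; case: ifP => // /UW->.
Qed.

Definition merge (x : {set V}) c a : {ffun V -> D} := [ffun v => if v \in x then c v else a v].

Section Elimination.
Variable R : comNzRingType.
Implicit Types (L : seq {set V}) (w : {set V} -> {ffun V -> D} -> R).

Definition bag_sum L w : R :=
  \sum_(a | restr (vcover L) a == a) \prod_(B <- L) w B (restr B a).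

Definition message (x y : {set V}) w b : R :=
  \sum_(c | (restr x c == c) && (restr (x :&: y) c == restr (x :&: y) b)) w x c.

Definition absorb x y w B b : R := if B == y then w y b * message x y w b else w B b.

(** One step of variable elimination: the variables private to [x] are summed out, and the result
    depends only on [x :&: y], so it can be stored in the weight of [y]. *)
Lemma bag_sum_absorb x y L w : uniq L -> y \in L -> x :&: vcover L \subset y ->
  bag_sum (x :: L) w = bag_sum L (absorb x y w).
Proof.
move=> uL yL xy; rewrite /bag_sum; set U := vcover L.
have LU B : B \in L -> B \subset U.
  by move=> BL; apply/subsetP => v vB; apply/vcoverP; exists B.
rewrite (partition_big (restr U) (fun a => restr U a == a)) /=; last first.
  by move=> a _; rewrite restr_restr.
apply: eq_bigr => a' /eqP sa'.
transitivity ((\prod_(B <- L) w B (restr B a')) * message x y w (restr y a')); last first.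
  transitivity (\prod_(B <- L) (w B (restr B a') *
      if B == y then message x y w (restr y a') else 1)).
    rewrite big_split /=; congr (_ * _); rewrite (bigD1_seq y) //= eqxx.
    by rewrite -[LHS]mulr1; congr (_ * _); rewrite big1 // => B /negPf->.
  by apply: eq_bigr => B _; rewrite /absorb; case: eqP => [->|]; rewrite ?mulr1.
rewrite /message mulr_sumr.
(* An extension of [a'] is [a'] overwritten on [x] by some [c]; since [x] meets [U] inside [y], the
   two need only agree on [x :&: y]. *)
rewrite (reindex_onto (fun c => merge x c a') (restr x)) /=; last first.
  move=> a /andP[/eqP sa /eqP ra]; apply/ffunP => v; rewrite !ffunE -ra !ffunE.
  case: ifP => vx; first by rewrite ?vx.
  by rewrite -[in RHS]sa ffunE vcover_cons inE vx.
have mU c : restr (x :&: y) c == restr (x :&: y) (restr y a') -> restr U (merge x c a') = a'.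
  move=> /eqP/ffunP ag; apply/ffunP => v; rewrite -[in RHS]sa' !ffunE.
  case: ifP => // vU; case: ifP => // vx.
  have vy : v \in y by apply: (subsetP xy); rewrite inE vx.
  by have := ag v; rewrite !ffunE !inE vx vy.
apply: eq_big => [c|c].
  apply/andP/andP => [[/andP[/eqP sm /eqP rU] /eqP rx]|[/eqP sc ag]].
    split; first by rewrite -{1}rx restr_restr ?rx.
    apply/eqP/ffunP => v; rewrite !ffunE !inE; case: ifP => // /andP[vx vy].
    rewrite vy; have vU : v \in U by apply: (subsetP (LU y yL)).
    by have /ffunP/(_ v) := rU; rewrite !ffunE vU vx.
  have rx : restr x (merge x c a') = c.
    apply/ffunP => v; rewrite -[in RHS]sc !ffunE; by case: (v \in x).
  rewrite rx mU // !eqxx andbT; split=> //; apply/eqP/ffunP => v.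
  rewrite !ffunE vcover_cons inE; case: ifP => // /norP[/negPf-> vU].
  by rewrite -sa' ffunE (negPf vU).
move=> /andP[/andP[_ /eqP rU] /eqP rx]; rewrite big_cons rx mulrC; congr (_ * _).
by apply: eq_big_seq => B BL; rewrite -{2}rU restr_restr ?LU.
Qed.

Lemma bag_sum_nil w : bag_sum [::] w = 1.
Proof.
rewrite /bag_sum (big_pred1 [ffun=> d0]) ?big_nil // => a.
rewrite /vcover big_nil /=; apply/eqP/eqP => [<-|->]; by apply/ffunP => v; rewrite !ffunE ?inE.
Qed.

Lemma bag_sum1 x w : bag_sum [:: x] w = \sum_(c | restr x c == c) w x c.
Proof.
rewrite /bag_sum /vcover big_seq1; apply: eq_bigr => c /eqP cE.
by rewrite big_seq1 cE.
Qed.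

End Elimination.

Section EliminationCircuit.
Variables (F : fieldType) (k : nat) (T : {set V} -> {set {ffun V -> D}}) (N : nat).
Implicit Types (L : seq {set V}) (w : {set V} -> {ffun V -> D} -> mpoly F k).
Hypothesis T_restr : forall B c, c \in T B -> restr B c = c.

Lemma support_sum B w (P : pred {ffun V -> D}) : (forall c, c \notin T B -> w B c = 0) ->
  \sum_(c | (restr B c == c) && P c) w B c = \sum_(c <- enum (T B) | P c) w B c.
Proof.
move=> w0; rewrite big_filter_cond [LHS]big_mkcond [RHS]big_mkcond /=.
apply: eq_bigr => c _; case: (boolP (c \in T B)) => cT.
  by rewrite (T_restr cT) eqxx.
by rewrite w0 // if_same.
Qed.

(** Absorbing [x] into [y] costs, for each of the at most [N] elements of [T y], at most [N]
    additions over [T x] and one multiplication. *)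
Lemma bag_sum_circuit L w l : running L -> uniq L -> straight_line l -> 0 \in l -> 1 \in l ->
  (forall B, B \in L -> (#|T B| <= N)%N) ->
  (forall B c, B \in L -> c \in T B -> w B c \in l) ->
  (forall B c, B \in L -> c \notin T B -> w B c = 0) ->
  exists2 l', straight_line l' & (size l' <= size l + size L * (N * N.+1))%N /\ bag_sum L w \in l'.
Proof.
elim: L w l => [|x L IHL] w l /=.
  by move=> _ _ sl _ l1 _ _ _; exists l; rewrite ?bag_sum_nil ?addn0.
move=> /andP[rL hL] /andP[xL uL] sl l0 l1 cT wT w0.
have Tx : (#|T x| <= N)%N by rewrite cT ?mem_head.
have wx c : c \in T x -> w x c \in l by apply: wT; rewrite mem_head.
have wx0 c : c \notin T x -> w x c = 0 by apply: w0; rewrite mem_head.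
have fl c : w x c \in l by case: (boolP (c \in T x)) => [/wx|/wx0->].
case/orP: hL => [/eqP L0|/hasP[y yL xy]].
  have [l' [sl' _] [sz Sl']] := straight_line_sum (enum (T x)) (P := xpredT) sl l0 (fun c _ => fl c).
  exists l' => //; split; last first.
    rewrite L0 bag_sum1; rewrite -(support_sum xpredT wx0) in Sl'.
    by rewrite (eq_bigl _ _ (fun c => esym (andbT _))).
  by apply: leq_trans sz _; rewrite leq_add2l L0 mul1n -cardE; nia.
rewrite (bag_sum_absorb w uL yL xy).
have [l' [sl' ll'] [sz Hl']] : exists2 l', straight_line l' /\ {subset l <= l'} &
    (size l' <= size l + N * N.+1)%N /\ {in T y, forall b, absorb x y w y b \in l'}.
  have Ty : (#|T y| <= N)%N by rewrite cT // inE yL orbT.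
  suff [l' Hl' [sz inl']] : exists2 l', straight_line l' /\ {subset l <= l'} &
      (size l' <= size l + size (enum (T y)) * N.+1)%N /\
      {in enum (T y), forall b, absorb x y w y b \in l'}.
    exists l' => //; split=> [|b bT]; last by apply: inl'; rewrite mem_enum.
    by apply: leq_trans sz _; rewrite leq_add2l leq_mul2r -cardE Ty orbT.
  have sT : {subset enum (T y) <= T y} by move=> b; rewrite mem_enum.
  elim: (enum (T y)) sT => [|b s IHs] sT; first by exists l => //; split; rewrite ?addn0.
  have [|l1' [sl1 ll1] [sz1 in1]] := IHs; first by move=> c cs; apply: sT; rewrite inE cs orbT.
  have [l2 [sl2 l12] [sz2 in2]] := straight_line_sum (enum (T x))
    (P := fun c => restr (x :&: y) c == restr (x :&: y) b) sl1 (ll1 _ l0) (fun c _ => ll1 _ (fl c)).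
  rewrite -(support_sum (fun c => restr (x :&: y) c == restr (x :&: y) b) wx0) in in2.
  exists (absorb x y w y b :: l2); split.
  - split=> //; apply: Or33; exists (w y b).
      by apply/l12/ll1/wT; rewrite ?inE ?yL ?orbT // sT ?mem_head.
    by exists (message x y w b); rewrite /absorb ?eqxx.
  - by move=> p pl; rewrite inE l12 ?orbT // ll1.
  - have sx : (size (enum (T x)) <= N)%N by rewrite -cardE.
    rewrite /= mulSn addnCA addSn ltnS addnC.
    by apply: leq_trans sz2 (leq_add sz1 sx).
  - move=> c; rewrite !inE => /orP[/eqP->|cs]; first by rewrite eqxx.
    by rewrite l12 ?orbT // in1.
have [|||B c BL cB|B c BL cB|l2 sl2 [sz2 in2]] := IHL (absorb x y w) l' rL uL sl'.
- exact: ll'.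
- exact: ll'.
- by move=> B BL; rewrite cT // inE BL orbT.
- move: cB; rewrite /absorb; case: eqP => [->|_] cB.
    by have := Hl' c cB; rewrite /absorb eqxx.
  by apply/ll'/wT; rewrite // inE BL orbT.
(* The absorbed weight keeps [w y] as a factor, so supports never grow. *)
- rewrite /absorb; case: eqP => [By|_]; last by rewrite w0 // inE BL orbT.
  by rewrite -By w0 ?mul0r // inE BL orbT.
exists l2 => //; split=> //; apply: leq_trans sz2 _.
by rewrite mulSn addnA leq_add2r.
Qed.

End EliminationCircuit.
End Restriction.

(** * Circuits for acyclic queries *)

Lemma mem_sumn (s : seq nat) x : x \in s -> (x <= sumn s)%N.
Proof.
elim: s => //= y s IHs; rewrite inE => /orP[/eqP->|/IHs/leq_trans]; first exact: leq_addr.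
by apply; rewrite leq_addl.
Qed.

(** A singleton meets the later bags either in nothing or inside any bag containing its point. *)
Lemma running_singletons (V : finType) (s : seq V) (L : seq {set V}) :
  running L -> running ([seq [set x] | x <- s] ++ L).
Proof.
move=> rL; elim: s => //= x s ->; set L' := _ ++ L; rewrite /=.
have [xL|xL] := boolP (x \in vcover L'); last first.
  case: L' xL => //= B L' xL; apply/orP; left; apply/subsetP => v; rewrite inE => /andP[].
  by rewrite inE => /eqP->; rewrite (negPf xL).
have /vcoverP[B BL xB] := xL; apply/orP; right; apply/hasP; exists B => //.
by apply/subsetP => v; rewrite inE => /andP[]; rewrite inE => /eqP->.
Qed.

Section FreeAssignments.
Variables (F : fieldType) (P : CQ) (d0 : 'I_(cq_dom P)).
Hypothesis wfP : cq_wf P.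
Local Notation V := 'I_(cq_nv P).
Local Notation D := 'I_(cq_dom P).
Local Notation S := (cq_free P).
Local Notation E := (cq_edges P).
Local Notation restr := (restr d0).

Definition traces (B : {set V}) : {set {ffun V -> D}} :=
  [set restr B b | b in [set b | @cq_sat P b]].

Lemma tracesP B c :
  reflect (exists2 b, @cq_sat P b & c = restr B b) (c \in traces B).
Proof. by apply: (iffP imsetP) => -[b]; rewrite ?inE => sb ->; exists b; rewrite ?inE. Qed.

Lemma traces_restr B c : c \in traces B -> restr B c = c.
Proof. by case/tracesP => b _ ->; rewrite restr_restr. Qed.

Lemma cqQ_traces : cqQ F P = \sum_(a in traces S) \prod_(x in S) mvar F (cq_dom P) (a x).
Proof.
pose h (c : {ffun V -> D}) : {ffun fvar P -> D} := [ffun x => c (val x)].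
pose h' (a : {ffun fvar P -> D}) : {ffun V -> D} :=
  [ffun v => if insub v is Some x then a x else d0].
rewrite /cqQ (reindex_onto h h') /=; last first.
  by move=> a _; apply/ffunP => x; rewrite !ffunE valK.
have hK c : h' (h c) = restr S c.
  apply/ffunP => v; rewrite !ffunE; case: insubP => [x vS <-|/negPf->//].
  by rewrite ffunE (valP x).
apply: eq_big => [c|c _].
  rewrite hK; apply/andP/idP => [[/existsP[b /andP[sb /forallP bc]] /eqP cE]|cS].
    apply/tracesP; exists b => //; rewrite -cE; apply/ffunP => v; rewrite !ffunE.
    case: ifP => // vS; have := bc (Sub v vS); rewrite ffunE SubK => /eqP->.
    by [].
  rewrite traces_restr //; split=> //; case/tracesP: cS => b sb ->.
  apply/existsP; exists b; rewrite sb; apply/forallP => x.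
  by rewrite !ffunE (valP x).
by rewrite [RHS]big_sub; apply: eq_bigr => x _; rewrite ffunE.
Qed.

Lemma card_traces_sub (B W : {set V}) : B \subset W -> (#|traces B| <= #|traces W|)%N.
Proof.
move=> BW; suff -> : traces B = [set restr B c | c in traces W] by apply: leq_imset_card.
apply/setP => c; apply/tracesP/imsetP => [[b sb ->]|[b' /tracesP[b sb ->] ->]].
  by exists (restr W b); [apply/tracesP; exists b | rewrite restr_restr].
by exists b => //; rewrite restr_restr.
Qed.

Lemma card_traces0 : (#|traces set0| <= 1)%N.
Proof.
rewrite -(cards1 [ffun _ : V => d0]); apply: subset_leq_card; apply/subsetP => c.
by case/tracesP => b _ ->; rewrite inE; apply/eqP/ffunP => v; rewrite !ffunE inE.
Qed.

Lemma card_tracesU (B W : {set V}) : (#|traces (B :|: W)| <= #|traces B| * #|traces W|)%N.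
Proof.
rewrite -cardsX -(card_in_imset (f := fun c => (restr B c, restr W c))) => [|c c' cT c'T].
  apply: subset_leq_card; apply/subsetP => p /imsetP[c /tracesP[b sb ->] ->].
  by rewrite inE /= !restr_restr ?subsetUl ?subsetUr //; apply/andP; split; apply/tracesP; exists b.
case=> /ffunP EB /ffunP EW; rewrite -(traces_restr cT) -(traces_restr c'T).
apply/ffunP => v; rewrite !ffunE inE; have := EW v; have := EB v; rewrite !ffunE.
by case: ifP => //= _ _; case: ifP.
Qed.

Lemma card_traces1 x : (#|traces [set x]| <= cq_dom P)%N.
Proof.
rewrite -[leqRHS]card_ord -(card_in_imset (f := fun c : {ffun V -> D} => c x)) ?max_card //.
move=> c c' /traces_restr <- /traces_restr <-; rewrite !ffunE inE eqxx => cx.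
by apply/ffunP => v; rewrite !ffunE inE; case: eqP => // ->.
Qed.

Lemma edgeP (e : {set V}) : reflect (exists2 a, a \in cq_atoms P & e = [set x in a.2]) (e \in E).
Proof. by rewrite inE; apply: (iffP mapP) => -[a aP ->]; exists a. Qed.

(** The tuple to which a satisfying assignment sends an atom determines the restriction to its edge,
    so traces inject into the relation. *)
Lemma card_traces_edge e : e \in E -> (#|traces e| <= (cq_size P).+1)%N.
Proof.
case/edgeP => a aP ->; have /andP[/allP wr /allP wa] := wfP.
have /andP[ar /eqP sz] := wa a aP; set r := nth _ _ _ in sz.
(* Empty tuples have length 0 and escape the total length of the tuples, so atoms without arguments
   are treated apart. *)
have [a0|a0] := posnP (size a.2).
  have -> : [set x in a.2] = set0 :> {set V}.
    by apply/setP => x; rewrite !inE (size0nil a0).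
  exact: leq_trans card_traces0 _.
have rP : r \in cq_rels P by apply: mem_nth.
apply: (@leq_trans (size r.2)).
  rewrite cardE -(size_map (fun c : {ffun V -> D} => map c a.2)); apply: uniq_leq_size.
    rewrite map_inj_in_uniq ?enum_uniq // => c c'; rewrite !mem_enum => cT c'T /eq_in_map cc.
    rewrite -(traces_restr cT) -(traces_restr c'T); apply/ffunP => v; rewrite !ffunE inE.
    by case: ifP => // /cc.
  move=> t /mapP[c]; rewrite mem_enum => /tracesP[b sb ->] ->.
  rewrite (_ : map _ _ = map b a.2); first by have /allP/(_ a aP) := sb.
  by apply/eq_in_map => x xa; rewrite ffunE inE xa.
apply: (@leq_trans (sumn (map size r.2))).
  have := wr r rP; rewrite -sz in a0 *; elim: (r.2) => //= t s IHs /andP[/eqP-> /IHs H].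
  by rewrite -add1n leq_add.
apply: leqW; rewrite /cq_size; apply: leq_trans (leq_addl _ _).
apply: (@leq_trans (r.1 + sumn (map size r.2)).+1); first by rewrite leqW // leq_addl.
by apply: mem_sumn; apply/mapP; exists r.
Qed.

Lemma card_traces_cover C : {subset C <= E} ->
  (#|traces (vcover C)| <= (cq_size P).+1 ^ size C)%N.
Proof.
elim: C => [|e C IHC] CE; first by rewrite /vcover big_nil expn0 card_traces0.
rewrite vcover_cons expnS; apply: leq_trans (card_tracesU _ _) _; apply: leq_mul.
  by apply: card_traces_edge; rewrite CE ?mem_head.
by apply: IHC => f fC; rewrite CE // inE fC orbT.
Qed.

(* Distinct components may share their bag; one witness per bag suffices, because every witness
   satisfies the whole query. *)
Lemma traces_glue a :
  (forall e, e \in E -> restr (comp_bag E S e) a \in traces (comp_bag E S e)) ->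
  restr S a \in traces S.
Proof.
move=> H; pose wit B := if [pick b | @cq_sat P b && (restr B b == restr B a)] is Some b
  then b else a.
have witP e : e \in E -> @cq_sat P (wit (comp_bag E S e)) /\
    restr (comp_bag E S e) (wit (comp_bag E S e)) = restr (comp_bag E S e) a.
  move=> eE; rewrite /wit; case: pickP => [b /andP[sb /eqP]//|nb].
  by have /tracesP[b sb bE] := H e eE; have := nb b; rewrite sb bE eqxx.
(* A quantified variable takes its value from the bag of any edge containing it; edges sharing a
   quantified variable have equal bags, so the edge chosen does not matter. *)
pose b := [ffun v => if v \in S then a v else
  if [pick e | (e \in E) && (v \in e)] is Some e then wit (comp_bag E S e) v else d0].
apply/tracesP; exists b; last first.
  by apply/ffunP => v; rewrite !ffunE; case: ifP.
apply/allP => atm atP; set e := [set x in atm.2].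
have eE : e \in E by apply/edgeP; exists atm.
have [/allP/(_ _ atP) wP wE] := witP e eE.
rewrite (_ : map _ _ = map (wit (comp_bag E S e)) atm.2) //; apply/eq_in_map => x xa.
have xe : x \in e by rewrite inE.
rewrite ffunE; case: ifP => xS.
  by have /ffunP/(_ x) := wE; rewrite !ffunE !inE xa xS.
case: pickP => [f /andP[fE xf]|/(_ e)]; last by rewrite eE xe.
have nS (g : {set V}) : x \in g -> ~~ (g \subset S).
  by move=> xg; apply/subsetPn; exists x; rewrite ?xS.
by rewrite (comp_bag_share (u := x) fE eE) ?xS.
Qed.

End FreeAssignments.

Section QueryCircuit.
Variables (F : fieldType) (P : CQ) (d0 : 'I_(cq_dom P)).
Local Notation V := 'I_(cq_nv P).
Local Notation D := 'I_(cq_dom P).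
Local Notation S := (cq_free P).
Local Notation E := (cq_edges P).
Local Notation X := (mvar F (cq_dom P)).
Local Notation T := (traces d0).

(* The variable [X_(c x)] is charged to the bag [{x}]. *)
Definition bag_weight (B : {set V}) (c : {ffun V -> D}) : mpoly F (cq_dom P) :=
  if c \in T B then \prod_(x in S | [set x] == B) X (c x) else 0.

(** The singletons also cover the free variables that occur in no atom. *)
Definition query_bags (L : seq {set V}) : seq {set V} :=
  undup ([seq [set x] | x <- enum S] ++ L).

Lemma mem_query_bags L B :
  (B \in query_bags L) = (B \in [seq [set x] | x <- enum S]) || (B \in L).
Proof. by rewrite mem_undup mem_cat. Qed.

Lemma bag_weight_label B c : c \in T B ->
  bag_weight B c = 1 \/ exists d : D, bag_weight B c = X d.
Proof.
rewrite /bag_weight => ->; case: (pickP [pred x in S | [set x] == B]) => [x /andP[xS /eqP xB]|no].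
  right; exists (c x); rewrite (big_pred1 x) // => y; rewrite -xB /=.
  rewrite (inj_eq set1_inj) andbC; case: eqP => //= ->; exact: xS.
by left; rewrite big_pred0.
Qed.

Lemma bag_sum_query L : (forall B, (B \in L) = (B \in [seq comp_bag E S e | e <- enum E])) ->
  bag_sum d0 (query_bags L) bag_weight = cqQ F P.
Proof.
move=> memL; set K := query_bags L.
have KS B : B \in K -> B \subset S.
  rewrite mem_query_bags => /orP[/mapP[x]|]; first by rewrite mem_enum => xS ->; rewrite sub1set.
  by rewrite memL => /mapP[e _ ->]; apply: subsetIr.
have K1 x : x \in S -> [set x] \in K.
  by move=> xS; rewrite mem_query_bags map_f ?mem_enum.
have coverK : vcover K = S.
  apply/setP => x; apply/vcoverP/idP => [[B /KS/subsetP BS /BS //]|xS].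
  by exists [set x]; rewrite ?K1 ?inE.
rewrite /bag_sum coverK (cqQ_traces F d0) big_mkcond [RHS]big_mkcond /=.
apply: eq_bigr => a _; case: (boolP (a \in T S)) => aT.
  have aE := traces_restr aT; rewrite aE eqxx.
  transitivity (\prod_(B <- K) \prod_(x in S | [set x] == B) X (a x)).
    apply: eq_big_seq => B BK; rewrite /bag_weight; case: ifP => [_|/negP[]].
      by apply: eq_bigr => x /andP[_ /eqP xB]; rewrite ffunE -xB inE eqxx.
    by case/tracesP: aT => b sb ->; rewrite restr_restr ?KS //; apply/tracesP; exists b.
  rewrite (exchange_big_dep (fun x => x \in S)) /=; last by move=> B x _ /andP[].
  apply: eq_bigr => x xS; rewrite big_mkcond (bigD1_seq [set x]) ?undup_uniq ?K1 //= xS eqxx.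
  by rewrite big1 ?mulr1 // => B; rewrite eq_sym => /negPf->.
(* By [traces_glue] an assignment that is not an answer fails on some bag, whose weight is then
   0. *)
case: eqP => // aE; have /existsP[B /andP[BK BT]] :
    [exists B, (B \in K) && (restr d0 B a \notin T B)].
  apply: contraR aT => /existsPn H; rewrite -aE.
  apply: traces_glue => e eE; have := H (comp_bag E S e); rewrite negb_and negbK => /orP[/negP[]|//].
  by rewrite mem_query_bags memL map_f ?orbT // mem_enum.
by rewrite (bigD1_seq B) ?undup_uniq //= /bag_weight (negPf BT) mul0r.
Qed.

Lemma query_circuit c : cq_wf P -> hyp_acyclic E -> (cq_qss P <= c)%N ->
  exists2 C : seq (gate F),
    (size C <= (cq_size P).+2 + (cq_size P + cq_size P) *
       ((cq_size P).+1 ^ c.+1 * ((cq_size P).+1 ^ c.+1).+1))%N &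
    circuit_output (cq_dom P) C = cqQ F P.
Proof.
(* Bags are covered by at most [c] edges, or by one edge when [e] lies inside [S]; the exponent
   [c.+1] serves both, and the singletons as well. *)
move=> wfP [k [par [lab JT]]] qc; set s := cq_size P; set N := (s.+1 ^ c.+1)%N.
set L := comp_bags E S lab; have memL := mem_comp_bags S JT.
have [ds vs szs] : [/\ cq_dom P <= s, cq_nv P <= s & cq_dom P + cq_nv P + size (cq_atoms P) <= s]%N.
  have : (size (cq_atoms P) <= sumn [seq (size a.2).+1 | a <- cq_atoms P])%N.
    elim: (cq_atoms P) => //= a l IHl; rewrite addSn ltnS.
    exact: leq_trans IHl (leq_addl _ _).
  by rewrite /s /cq_size => h; split; lia.
pose l0 := [:: 0; 1] ++ [seq X (d : D) | d <- enum D].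
have sl0 : straight_line l0.
  have labs (l : seq (mpoly F (cq_dom P))) : (forall p, p \in l -> is_label p) -> straight_line l.
    elim: l => //= p l IHl H; split; last by apply: Or31; apply: H; rewrite mem_head.
    by apply: IHl => q ql; apply: H; rewrite inE ql orbT.
  apply: labs => p; rewrite !inE => /or3P[/eqP->|/eqP->|/mapP[d _ ->]].
  - by exists (inl 0); rewrite /= rmorph0.
  - by exists (inl 1); rewrite /= rmorph1.
  - by exists (inr (d : nat)).
have l00 : 0 \in l0 by rewrite mem_head.
have l01 : 1 \in l0 by rewrite inE mem_head orbT.
have cardT B : B \in query_bags L -> (#|T B| <= N)%N.
  have pow j : (j <= c.+1)%N -> (s.+1 ^ j <= N)%N by move=> jc; rewrite leq_pexp2l.
  rewrite mem_query_bags => /orP[/mapP[x _ ->]|].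
    apply: leq_trans (card_traces1 _ _) _; apply: leq_trans ds _.
    by apply: leq_trans (leqnSn s) _; rewrite -{1}(expn1 s.+1) pow.
  rewrite memL => /mapP[e]; rewrite mem_enum => eE ->.
  have [eS|eS] := boolP (e \subset S).
    apply: leq_trans (card_traces_sub d0 (_ : _ \subset e)) _.
      rewrite /comp_bag /comp_verts comp_edges_sub // big_set0 setU0; exact: subsetIl.
    apply: leq_trans (card_traces_edge d0 wfP eE) _; rewrite -(expn1 (cq_size P).+1); exact: pow.
  have [C szC [CE BC]] := comp_cover JT eE eS.
  apply: leq_trans (card_traces_sub d0 BC) _; apply: leq_trans (card_traces_cover d0 wfP CE) _.
  by apply: pow; apply: leqW; apply: leq_trans szC qc.
have wl B b : b \in T B -> bag_weight B b \in l0.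
  case/bag_weight_label => [->//|[d ->]].
  by rewrite mem_cat; apply/orP; right; apply/mapP; exists d; rewrite ?mem_enum.
have [l' sl' [szl' Ql']] := @bag_sum_circuit _ _ d0 F _ T N (@traces_restr P d0) (query_bags L)
  bag_weight l0 (running_undup (running_singletons _ (running_comp_bags S JT))) (undup_uniq _)
  sl0 l00 l01 cardT (fun B b _ => @wl B b)
  (fun B b _ nb => ifN _ _ nb).
rewrite (bag_sum_query memL) in Ql'.
have [C szC CE] := straight_line_output sl' Ql'; exists C => //.
apply: (leq_trans szC); apply: (leq_trans szl'); apply: leq_add.
  by rewrite size_cat size_map -cardE card_ord.
rewrite leq_mul2r; apply/orP; right; apply: leq_trans (size_undup _) _.
rewrite size_cat size_map -cardE; apply: leq_add.
  by apply: leq_trans (max_card _) _; rewrite card_ord.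
have : {subset L <= [seq comp_bag E S e | e <- enum E]} by move=> B; rewrite memL.
move/(uniq_leq_size (undup_uniq _))/leq_trans; apply; rewrite size_map -cardE.
apply: (@leq_trans (size (cq_atoms P))); last by lia.
rewrite /cq_edges -(size_map (fun a : nat * seq V => [set x in a.2])).
by rewrite cardsE; exact: card_size.
Qed.

End QueryCircuit.

(** This settles the empty domain, which offers no default element [d0]: a single constant gate is
    enough. *)
Lemma mpoly0_const (R : comNzRingType) k (p : mpoly R k) : k = 0%N -> exists c, p = mconst k c.
Proof. by move=> k0; move: p; rewrite k0 => p; exists p. Qed.

Lemma mdeg_cqQ (F : fieldType) (P : CQ) : (mdeg (cqQ F P) <= cq_nv P)%N.
Proof.
apply: mdeg_sum => a _; apply: leq_trans (mdeg_prod _ _ _) _.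
apply: (@leq_trans (\sum_(x : fvar P) 1)%N); first by apply: leq_sum => x _; exact: mdeg_mvar.
by rewrite sum1_card card_sig; apply: leq_trans (max_card _) _; rewrite card_ord.
Qed.

Lemma acyclic_queries_VP (F : fieldType) (Phi : nat -> CQ) :
  (forall n, cq_wf (Phi n)) ->
  poly_bounded (fun n => cq_size (Phi n)) ->
  (forall n, hyp_acyclic (cq_edges (Phi n))) ->
  (exists c : nat, forall n, (cq_qss (Phi n) <= c)%N) ->
  inVP (fun n => cqQ F (Phi n)).
Proof.
move=> wf ps ac [c qc]; split.
  apply: poly_bounded_leq ps => n; apply: leq_trans (mdeg_cqQ _ _) _.
  by rewrite /cq_size; lia.
set s := fun n => cq_size (Phi n) in ps.
exists (fun n => (s n).+2 + (s n + s n) * ((s n).+1 ^ c.+1 * ((s n).+1 ^ c.+1).+1))%N.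
split=> [|n]; first by auto 20 with poly_bounded.
have [d0|d0] := posnP (cq_dom (Phi n)); last first.
  by have [C szC CE] := query_circuit F (Ordinal d0) (wf n) (ac n) (qc n); exists C.
have [a aE] := mpoly0_const (cqQ F (Phi n)) d0.
by exists [:: Gconst a]; rewrite aE.
Qed.

Theorem mainTheorem17 :
  (forall (F : fieldType) (Phi : nat -> CQ),
      (forall n, cq_wf (Phi n)) ->
      poly_bounded (fun n => cq_size (Phi n)) ->
      (forall n, hyp_acyclic (cq_edges (Phi n))) ->
      (exists c : nat, forall n, (cq_qss (Phi n) <= c)%N) ->
      inVP (fun n => cqQ F (Phi n)))
  /\
  (forall (F : fieldType) (k : nat -> nat) (f : forall n, mpoly F (k n)),
      inVP f ->
      exists Phi : nat -> CQ,
        [/\ forall n, cq_wf (Phi n),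
            forall n, quantifier_free (Phi n),
            forall n, hyp_is_tree (cq_edges (Phi n)),
            poly_bounded (fun n => cq_size (Phi n)) &
            p_projection f (fun n => cqQ F (Phi n))]).
Proof. by split; [exact: acyclic_queries_VP | exact: VP_tree_projection]. Qed.
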